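(* Let $G=\mathbb{C}$ or $G=\mathbb{D}$ and let $u$ and $v$ be weights on $G$. Then the following are equivalent: (i) $\widetilde{u}\preceq v$; (ii) $\widetilde{u}\preceq\widetilde{v}$; (iii) $H^{\infty}_u(G)\subseteq H^{\infty}_v(G)$ (with continuous inclusion). Thus, if $u$ is essential, then the inclusion in (iii) holds if and only if $u\preceq v$.
   Context: For $G=\mathbb{C}$, a weight is a function $v:[0,+\infty)\to(0,+\infty)$ that is continuous, non-increasing and rapidly decreasing, i.e. $\lim_{t\to+\infty}t^kv(t)=0$ for all $k\ge 0$. For $G=\mathbb{D}$ (the open unit disc), a weight is a continuous non-increasing function $v:[0,1)\to(0,+\infty)$. Let $I_G=[0,+\infty)$ if $G=\mathbb{C}$ and $I_G=[0,1)$ if $G=\mathbb{D}$. $H(G)$ is the space of holomorphic functions on $G$, and $H^{\infty}_v(G):=\{f\in H(G):\|f\|_v:=\sup_{z\in G}|f(z)|v(|z|)<+\infty\}$, a Banach space with norm $\|\cdot\|_v$. For strictly positive functions $v,w$ on $I_G$, write $v\preceq w$ if there is $C\ge 1$ with $w(t)\le Cv(t)$ for all $t\in I_G$; write $v\sim w$ if $v\preceq w$ and $w\preceq v$. For a weight $v$ on $G$ put $w_v:=1/v$, $B_{w_v}(G):=\{f\in H(G):|f(z)|\le w_v(|z|)\ \forall z\in G\}$, $\widetilde{w_v}(z):=\sup\{|f(z)|:f\in B_{w_v}(G)\}$ for $z\in G$ (this is a radial function, hence regarded as a function of $t=|z|\in I_G$), and $\widetilde{v}:=1/\widetilde{w_v}$.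 The weight $v$ is called essential (on $G$) if $v\sim\widetilde{v}$. *)

(* Defs.v *)
From Stdlib Require Import Reals.
From Coquelicot Require Import Coquelicot.
Open Scope R_scope.

Inductive region : Set := plane | disc.

Definition in_region (G : region) (z : C) : Prop :=
  match G with
  | plane => True
  | disc => Cmod z < 1
  end.

Definition radii (G : region) (t : R) : Prop :=
  match G with
  | plane => 0 <= t
  | disc => 0 <= t < 1
  end.

(* Functions on [0,+oo), [0,1) and G are represented by total functions, of
   which only the values on the relevant domain matter: [continuous_on] is
   continuity relative to [radii G], and since G is open, differentiability at
   a point of G does not depend on the values taken outside G. *)

Definition rapidly_decreasing (v : R -> R) : Prop :=
  forall k : nat, is_lim (fun t => t ^ k * v t) p_infty 0.

Record is_weight (G : region) (v : R -> R) : Prop := {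
  weight_pos : forall t, radii G t -> 0 < v t;
  weight_cont : continuous_on (radii G) v;
  weight_noninc : forall s t, radii G s -> radii G t -> s <= t -> v t <= v s;
  weight_decr : G = plane -> rapidly_decreasing v
}.

Definition holomorphic (G : region) (f : C -> C) : Prop :=
  forall z, in_region G z -> ex_derive (K := C_AbsRing) (V := C_NormedModule) f z.

Definition wnorm (G : region) (v : R -> R) (f : C -> C) : Rbar :=
  Lub_Rbar (fun x => exists z, in_region G z /\ x = Cmod (f z) * v (Cmod z)).

Definition Hinf (G : region) (v : R -> R) (f : C -> C) : Prop :=
  holomorphic G f /\ Rbar_lt (wnorm G v f) p_infty.

Definition Hinf_incl (G : region) (u v : R -> R) : Prop :=
  forall f, Hinf G u f -> Hinf G v f.

(* Continuity of the identity map from (Hinf G u, wnorm G u) to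
   (Hinf G v, wnorm G v). *)
Definition Hinf_incl_continuous (G : region) (u v : R -> R) : Prop :=
  forall f, Hinf G u f ->
  forall eps, 0 < eps -> exists delta, 0 < delta /\
  forall g, Hinf G u g ->
    Rbar_lt (wnorm G u (fun z => Cminus (g z) (f z))) (Finite delta) ->
    Rbar_lt (wnorm G v (fun z => Cminus (g z) (f z))) (Finite eps).

Definition wpreceq (G : region) (v w : R -> R) : Prop :=
  exists K, 1 <= K /\ forall t, radii G t -> w t <= K * v t.

Definition wequiv (G : region) (v w : R -> R) : Prop :=
  wpreceq G v w /\ wpreceq G w v.

Definition growth (v : R -> R) (t : R) : R := / v t.

Definition growth_ball (G : region) (w : R -> R) (f : C -> C) : Prop :=
  holomorphic G f /\ forall z, in_region G z -> Cmod (f z) <= w (Cmod z).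

(* For w positive and z in G the set contains 0 and is bounded by [w (Cmod z)]: the
   supremum is finite and [real] loses nothing. *)
Definition assoc_growth (G : region) (w : R -> R) (z : C) : R :=
  real (Lub_Rbar (fun x => exists f, growth_ball G w f /\ x = Cmod (f z))).

(* [growth_ball] is invariant under rotations of the variable, so
   [assoc_growth G w z] depends only on |z|, and the associated radial function
   of t is its value at z = t. *)
Definition assoc_weight (G : region) (v : R -> R) (t : R) : R :=
  / assoc_growth G (growth v) (RtoC t).

Definition essential (G : region) (v : R -> R) : Prop :=
  wequiv G v (assoc_weight G v).

(* Main.v *)
Require Import Defs.
From Stdlib Require Import Reals Lra Lia Classical.
From Stdlib Require Import IndefiniteDescription ClassicalEpsilon.
From Coquelicot Require Import Coquelicot.
Open Scope R_scope.

(** Write [A_u] for [assoc_growth G (growth u)], the largest modulus that a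
    function of the unit ball of [Hinf G u] takes at a given point.  The
    relation [wpreceq G (assoc_weight G u) v] says that [A_u * v] is bounded.  If it is bounded by K, every f of norm
    at most M in [Hinf G u] satisfies |f| <= M A_u <= K M / v, which gives the
    inclusion, its continuity, and, applied to the unit ball, [A_u <= K A_v];
    rotations of the variable let one test on the positive radius only
    ([assoc_growth_radial], [assoc_bound_transfers]).  Since [A_v <= 1/v],
    a bound [A_u <= K A_v] gives back that of [A_u * v].

    The substance is that the bare inclusion already bounds [A_u * v]
    ([inclusion_bounds_assoc_growth]).  Instead of
    the closed graph theorem, a gliding hump is used.  If [A_u * v] is unbounded,
    pick points p_n where it exceeds n 8^n and functions f_n of the unit ball
    with |f_n (p_n)| at least half of [A_u (p_n)].  With coefficients s_n equal
    to 0 or 8^-n, chosen one after the other so that the partial sum up to n is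
    large at p_n, the later terms cannot destroy what was gained, because each
    of them is at most 8^-k A_u (p_n) there.  The sum F then lies in
    [Hinf G u] and |F (p_n)| v(|p_n|) is at least of order n, so F is outside
    [Hinf G v] ([gliding_hump]).

    That F is holomorphic is the theorem of Weierstrass on locally uniform
    limits, for functions that are only assumed to have a complex derivative at
    each point.  Its proof needs a single estimate, valid for f holomorphic and
    bounded by M on a disc of radius 2 rho about a:
    |f w - f a| <= (2 M / rho) |w - a| for |w - a| <= rho
    ([difference_quotient_bound]).  It makes the
    difference quotients of a uniformly convergent sequence converge uniformly,
    and so lets the limit and the derivative be exchanged
    ([uniform_limit_derivable]).  The estimate is the maximum principle applied
    to the difference quotient q(z) = (f z - f a) / (z - a), a function which is
    continuous at a but not known to be differentiable there.

    The maximum principle follows from the mean value property on small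
    circles, and the latter from Goursat's theorem on rectangles in polar
    coordinates: with f = U + i V, the imaginary part of f dz / (z - c) is the
    form V dr / r + U dt, which is closed for r > 0 when f is holomorphic off c,
    so that the integral of U over circles about c does not depend on the radius
    and tends to 2 pi U(c) when the radius tends to 0.  The centre needs only
    continuity, which is what allows q to be treated. *)

(** * Bisection of rectangles *)

Lemma nested_intervals (x l : nat -> R) :
  (forall n, 0 <= l n) ->
  (forall n, x n <= x (S n)) ->
  (forall n, x (S n) + l (S n) <= x n + l n) ->
  exists p, forall n, x n <= p <= x n + l n.
Proof.
intros Hl Hx Hr.
assert (Hx' : forall n k, x n <= x (n + k)%nat).
{ intros n k; induction k as [|k IH]; [rewrite Nat.add_0_r; lra|].
  rewrite Nat.add_succ_r; specialize (Hx (n + k)%nat); lra. }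
assert (Hr' : forall n k, x (n + k)%nat + l (n + k)%nat <= x n + l n).
{ intros n k; induction k as [|k IH]; [rewrite Nat.add_0_r; lra|].
  rewrite Nat.add_succ_r; specialize (Hr (n + k)%nat); lra. }
assert (Hb : forall m n, x m <= x n + l n).
{ intros m n; pose proof (Hx' m n); pose proof (Hr' n m); pose proof (Hl (m + n)%nat).
  replace (n + m)%nat with (m + n)%nat in * by lia; lra. }
destruct (completeness (fun t => exists n, t = x n)) as [p [Hp1 Hp2]].
- exists (x 0%nat + l 0%nat); intros t [n ->]; apply Hb.
- now exists (x 0%nat), 0%nat.
- exists p; intros n; split.
  + now apply Hp1; exists n.
  + apply Hp2; intros t [m ->]; apply Hb.
Qed.

Lemma small_half_pow (delta : R) : 0 < delta -> exists n, 0 < (/ 2) ^ n < delta.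
Proof.
intros Hd.
destruct (pow_lt_1_zero (/ 2)) with (y := delta) as [N HN]; auto.
- rewrite Rabs_right; lra.
- exists N; assert (0 < (/ 2) ^ N) by (apply pow_lt; lra).
  specialize (HN N (le_n N)); rewrite Rabs_right in HN; lra.
Qed.

(** Both the theorem of Goursat and the compactness of the rectangle are
    consequences of this principle: a property that passes from the four quarters
    of a rectangle to the rectangle and holds for the small rectangles around each
    point holds globally, since otherwise repeated quartering would shrink to a
    point contradicting the local hypothesis.  [P x y s] speaks of the rectangle
    with lower left corner (x, y) and sides s a and s b, so that all the
    rectangles involved are similar. *)
Lemma rectangle_bisection (P : R -> R -> R -> Prop) (x0 y0 a b : R) :
  0 < a -> 0 < b ->
  (forall x y s, 0 < s ->
     P x y (s / 2) -> P (x + s / 2 * a) y (s / 2) ->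
     P x (y + s / 2 * b) (s / 2) -> P (x + s / 2 * a) (y + s / 2 * b) (s / 2) ->
     P x y s) ->
  (forall p q, x0 <= p <= x0 + a -> y0 <= q <= y0 + b ->
     exists delta, 0 < delta /\ forall x y s, 0 < s < delta ->
       x <= p <= x + s * a -> y <= q <= y + s * b -> P x y s) ->
  P x0 y0 1.
Proof.
intros Ha Hb Hstep Hloc; apply NNPP; intros Hbad.
destruct (functional_choice (fun (r : (R * R) * R) (z : R * R) =>
    let (c, s) := r in 0 < s -> ~ P (fst c) (snd c) s ->
    ~ P (fst z) (snd z) (s / 2)
    /\ fst c <= fst z /\ fst z + s / 2 * a <= fst c + s * a
    /\ snd c <= snd z /\ snd z + s / 2 * b <= snd c + s * b)) as [g Hg].
{ intros [[x y] s]; simpl.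
  destruct (classic (0 < s /\ ~ P x y s)) as [[Hs H]|H].
  2:{ exists (x, y); intros; exfalso; tauto. }
  assert (0 < s * a /\ 0 < s * b) as [Hsa Hsb] by (split; apply Rmult_lt_0_compat; lra).
  destruct (classic (P x y (s / 2))) as [H1|H1].
  2:{ exists (x, y); simpl; repeat split; auto; lra. }
  destruct (classic (P (x + s / 2 * a) y (s / 2))) as [H2|H2].
  2:{ exists (x + s / 2 * a, y); simpl; repeat split; auto; lra. }
  destruct (classic (P x (y + s / 2 * b) (s / 2))) as [H3|H3].
  2:{ exists (x, y + s / 2 * b); simpl; repeat split; auto; lra. }
  destruct (classic (P (x + s / 2 * a) (y + s / 2 * b) (s / 2))) as [H4|H4].
  2:{ exists (x + s / 2 * a, y + s / 2 * b); simpl; repeat split; auto; lra. }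
  now destruct H; apply Hstep. }
pose (c := fix c n := match n with O => (x0, y0) | S m => g (c m, (/ 2) ^ m) end).
assert (Hs : forall n, 0 < (/ 2) ^ n) by (intros n; apply pow_lt; lra).
assert (Hc : forall n, ~ P (fst (c n)) (snd (c n)) ((/ 2) ^ n)).
{ induction n as [|n IH]; [exact Hbad|].
  destruct (Hg (c n, (/ 2) ^ n) (Hs n) IH) as [H _].
  replace ((/ 2) ^ S n) with ((/ 2) ^ n / 2) by (simpl; lra); exact H. }
assert (Hn : forall n,
    fst (c n) <= fst (c (S n)) /\
    fst (c (S n)) + (/ 2) ^ S n * a <= fst (c n) + (/ 2) ^ n * a /\
    snd (c n) <= snd (c (S n)) /\
    snd (c (S n)) + (/ 2) ^ S n * b <= snd (c n) + (/ 2) ^ n * b).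
{ intros n; destruct (Hg (c n, (/ 2) ^ n) (Hs n) (Hc n)) as [_ H].
  replace ((/ 2) ^ S n) with ((/ 2) ^ n / 2) by (simpl; lra); exact H. }
destruct (nested_intervals (fun n => fst (c n)) (fun n => (/ 2) ^ n * a)) as [p Hp];
  try (intros n; apply Hn).
{ intros n; apply Rmult_le_pos; [apply Rlt_le, Hs|lra]. }
destruct (nested_intervals (fun n => snd (c n)) (fun n => (/ 2) ^ n * b)) as [q Hq];
  try (intros n; apply Hn).
{ intros n; apply Rmult_le_pos; [apply Rlt_le, Hs|lra]. }
destruct (Hloc p q) as [delta [Hd H]].
- specialize (Hp 0%nat); simpl in Hp; lra.
- specialize (Hq 0%nat); simpl in Hq; lra.
- destruct (small_half_pow delta Hd) as [n Hn'].
  apply (Hc n), H; auto.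
Qed.

(** * Goursat's theorem for closed differential forms *)

(** The integral of P dx + Q dy along the boundary of the rectangle with corner
    (x, y), width w and height h.  Opposite sides are put under one integral so
    that the contribution of the affine part of P and Q is visible. *)
Definition circulation (P Q : R -> R -> R) (x y w h : R) : R :=
  RInt (fun t => P t y - P t (y + h)) x (x + w) +
  RInt (fun t => Q (x + w) t - Q x t) y (y + h).

Lemma continuity_2d_pt_slice1 (f : R -> R -> R) (x y : R) :
  continuity_2d_pt f x y -> continuous (fun t => f t y) x.
Proof.
intros H; apply continuity_pt_filterlim, continuity_pt_locally.
intros eps; destruct (H eps) as [d Hd]; exists d; intros t Ht.
apply Hd; [exact Ht|rewrite Rminus_diag, Rabs_R0; apply cond_pos].
Qed.

Lemma continuity_2d_pt_slice2 (f : R -> R -> R) (x y : R) :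
  continuity_2d_pt f x y -> continuous (fun t => f x t) y.
Proof.
intros H; apply continuity_pt_filterlim, continuity_pt_locally.
intros eps; destruct (H eps) as [d Hd]; exists d; intros t Ht.
apply Hd; [rewrite Rminus_diag, Rabs_R0; apply cond_pos|exact Ht].
Qed.

Lemma ex_RInt_slice1 (f : R -> R -> R) (y a b : R) :
  a <= b -> (forall t, a <= t <= b -> continuity_2d_pt f t y) ->
  ex_RInt (fun t => f t y) a b.
Proof.
intros Hab H; apply (@ex_RInt_continuous R_CompleteNormedModule).
rewrite Rmin_left, Rmax_right by exact Hab.
now intros t Ht; apply continuity_2d_pt_slice1, H.
Qed.

Lemma ex_RInt_slice2 (f : R -> R -> R) (x a b : R) :
  a <= b -> (forall t, a <= t <= b -> continuity_2d_pt f x t) ->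
  ex_RInt (fun t => f x t) a b.
Proof.
intros Hab H; apply (@ex_RInt_continuous R_CompleteNormedModule).
rewrite Rmin_left, Rmax_right by exact Hab.
now intros t Ht; apply continuity_2d_pt_slice2, H.
Qed.

Lemma RInt_minus_R (f g : R -> R) a b :
  ex_RInt f a b -> ex_RInt g a b ->
  RInt (fun t => f t - g t) a b = RInt f a b - RInt g a b.
Proof. exact (RInt_minus f g a b). Qed.

Lemma RInt_Chasles_R (f : R -> R) a b c :
  ex_RInt f a b -> ex_RInt f b c -> RInt f a c = RInt f a b + RInt f b c.
Proof. intros H1 H2; symmetry; exact (RInt_Chasles f a b c H1 H2). Qed.

Lemma circulation_sides (P Q : R -> R -> R) (x y w h : R) :
  0 <= w -> 0 <= h ->
  (forall s t, x <= s <= x + w -> y <= t <= y + h ->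
     continuity_2d_pt P s t /\ continuity_2d_pt Q s t) ->
  circulation P Q x y w h =
  RInt (fun t => P t y) x (x + w) - RInt (fun t => P t (y + h)) x (x + w) +
  (RInt (fun t => Q (x + w) t) y (y + h) - RInt (fun t => Q x t) y (y + h)).
Proof.
intros Hw Hh H; unfold circulation.
rewrite (RInt_minus_R (fun t => P t y) (fun t => P t (y + h))).
2, 3: apply ex_RInt_slice1; [lra|intros; apply H; lra].
rewrite (RInt_minus_R (fun t => Q (x + w) t) (fun t => Q x t)); [reflexivity| |].
all: apply ex_RInt_slice2; [lra|intros; apply H; lra].
Qed.

Lemma circulation_split_width (P Q : R -> R -> R) (x y w1 w2 h : R) :
  0 <= w1 -> 0 <= w2 -> 0 <= h ->
  (forall s t, x <= s <= x + w1 + w2 -> y <= t <= y + h ->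
     continuity_2d_pt P s t /\ continuity_2d_pt Q s t) ->
  circulation P Q x y (w1 + w2) h =
  circulation P Q x y w1 h + circulation P Q (x + w1) y w2 h.
Proof.
intros Hw1 Hw2 Hh H.
assert (E1 : forall u v t, x <= u -> u <= v -> v <= x + w1 + w2 -> y <= t <= y + h ->
             ex_RInt (fun s => P s t) u v).
{ intros; apply ex_RInt_slice1; auto; intros; apply H; lra. }
assert (E2 : forall s, x <= s <= x + w1 + w2 -> ex_RInt (fun t => Q s t) y (y + h)).
{ intros; apply ex_RInt_slice2; auto; [lra|]; intros; apply H; lra. }
rewrite !circulation_sides by (try lra; intros; apply H; lra).
replace (x + (w1 + w2)) with (x + w1 + w2) by ring.
rewrite (RInt_Chasles_R (fun t => P t y) x (x + w1) (x + w1 + w2)) by (apply E1; lra).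
rewrite (RInt_Chasles_R (fun t => P t (y + h)) x (x + w1) (x + w1 + w2)) by (apply E1; lra).
ring.
Qed.

Lemma circulation_split_height (P Q : R -> R -> R) (x y w h1 h2 : R) :
  0 <= w -> 0 <= h1 -> 0 <= h2 ->
  (forall s t, x <= s <= x + w -> y <= t <= y + h1 + h2 ->
     continuity_2d_pt P s t /\ continuity_2d_pt Q s t) ->
  circulation P Q x y w (h1 + h2) =
  circulation P Q x y w h1 + circulation P Q x (y + h1) w h2.
Proof.
intros Hw Hh1 Hh2 H.
assert (E1 : forall t, y <= t <= y + h1 + h2 -> ex_RInt (fun s => P s t) x (x + w)).
{ intros; apply ex_RInt_slice1; auto; [lra|]; intros; apply H; lra. }
assert (E2 : forall u v s, y <= u -> u <= v -> v <= y + h1 + h2 -> x <= s <= x + w ->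
             ex_RInt (fun t => Q s t) u v).
{ intros; apply ex_RInt_slice2; auto; intros; apply H; lra. }
rewrite !circulation_sides by (try lra; intros; apply H; lra).
replace (y + (h1 + h2)) with (y + h1 + h2) by ring.
rewrite (RInt_Chasles_R (fun t => Q (x + w) t) y (y + h1) (y + h1 + h2)) by (apply E2; lra).
rewrite (RInt_Chasles_R (fun t => Q x t) y (y + h1) (y + h1 + h2)) by (apply E2; lra).
ring.
Qed.

Lemma RInt_near_const (f : R -> R) (a w c e : R) :
  0 <= w -> ex_RInt f a (a + w) ->
  (forall t, a <= t <= a + w -> Rabs (f t - c) <= e) ->
  Rabs (RInt f a (a + w) - w * c) <= w * e.
Proof.
intros Hw Hf H.
replace (w * c) with (RInt (fun _ => c) a (a + w))
  by (rewrite (RInt_const a (a + w) c); unfold scal; simpl; unfold mult; simpl; ring).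
rewrite <- RInt_minus_R by (auto; apply ex_RInt_const).
replace (w * e) with ((a + w - a) * e) by ring.
apply abs_RInt_le_const; auto; [lra|].
apply (@ex_RInt_minus R_NormedModule); auto; apply ex_RInt_const.
Qed.

(** The form P dx + Q dy is closed at (x, y) in the pointwise sense: l is both
    the derivative of P in y and that of Q in x. *)
Definition closed_at (P Q : R -> R -> R) (x y : R) : Prop :=
  exists k l m, differentiable_pt_lim P x y k l /\ differentiable_pt_lim Q x y l m.

(** The affine parts of P and Q at (p, q) contribute - l w h and + l w h, where l is the
    common cross derivative, and cancel; the remainders are at most eta d on a
    boundary of length at most 4 d. *)
Lemma circulation_closed_small (P Q : R -> R -> R) (p q eta : R) :
  0 < eta -> closed_at P Q p q ->
  exists delta, 0 < delta /\ forall x y w h d,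
    0 <= w <= d -> 0 <= h <= d -> d < delta ->
    x <= p <= x + w -> y <= q <= y + h ->
    (forall s t, x <= s <= x + w -> y <= t <= y + h ->
       continuity_2d_pt P s t /\ continuity_2d_pt Q s t) ->
    Rabs (circulation P Q x y w h) <= 4 * eta * d ^ 2.
Proof.
intros He [k [l [m [HP HQ]]]].
destruct (HP (mkposreal eta He)) as [d1 H1].
destruct (HQ (mkposreal eta He)) as [d2 H2]; simpl in H1, H2.
exists (Rmin d1 d2); split; [apply Rmin_pos; apply cond_pos|].
intros x y w h d Hw Hh Hd Hp Hq Hc.
pose proof (Rmin_l d1 d2); pose proof (Rmin_r d1 d2).
assert (Hm : forall s t, x <= s <= x + w -> y <= t <= y + h ->
   eta * Rmax (Rabs (s - p)) (Rabs (t - q)) <= eta * d).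
{ intros s t Hs Ht; apply Rmult_le_compat_l; [lra|].
  apply Rmax_lub; apply Rabs_le; lra. }
assert (A1 : Rabs (RInt (fun t => P t y - P t (y + h)) x (x + w) - w * (- l * h))
             <= w * (2 * (eta * d))).
{ apply RInt_near_const; [lra| |].
  - apply (@ex_RInt_minus R_NormedModule);
      (apply ex_RInt_slice1; [lra|intros; apply Hc; lra]).
  - intros t Ht.
    assert (B1 : Rabs (t - p) < d1) by (apply Rabs_def1; lra).
    assert (B2 : Rabs (y - q) < d1) by (apply Rabs_def1; lra).
    assert (B3 : Rabs (y + h - q) < d1) by (apply Rabs_def1; lra).
    pose proof (H1 t y B1 B2) as C1; pose proof (H1 t (y + h) B1 B3) as C2.
    pose proof (Hm t y ltac:(lra) ltac:(lra)); pose proof (Hm t (y + h) ltac:(lra) ltac:(lra)).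
    apply Rabs_le_between in C1, C2; apply Rabs_le; lra. }
assert (A2 : Rabs (RInt (fun t => Q (x + w) t - Q x t) y (y + h) - h * (l * w))
             <= h * (2 * (eta * d))).
{ apply RInt_near_const; [lra| |].
  - apply (@ex_RInt_minus R_NormedModule);
      (apply ex_RInt_slice2; [lra|intros; apply Hc; lra]).
  - intros t Ht.
    assert (B1 : Rabs (t - q) < d2) by (apply Rabs_def1; lra).
    assert (B2 : Rabs (x - p) < d2) by (apply Rabs_def1; lra).
    assert (B3 : Rabs (x + w - p) < d2) by (apply Rabs_def1; lra).
    pose proof (H2 x t B2 B1) as C1; pose proof (H2 (x + w) t B3 B1) as C2.
    pose proof (Hm x t ltac:(lra) ltac:(lra)); pose proof (Hm (x + w) t ltac:(lra) ltac:(lra)).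
    apply Rabs_le_between in C1, C2; apply Rabs_le; lra. }
unfold circulation.
apply Rabs_le_between in A1, A2.
assert (0 <= eta * d) by (apply Rmult_le_pos; lra).
assert (w * (2 * (eta * d)) <= d * (2 * (eta * d))) by (apply Rmult_le_compat_r; lra).
assert (h * (2 * (eta * d)) <= d * (2 * (eta * d))) by (apply Rmult_le_compat_r; lra).
apply Rabs_le; split; nra.
Qed.

Lemma closed_at_continuity (P Q : R -> R -> R) (x y : R) :
  closed_at P Q x y -> continuity_2d_pt P x y /\ continuity_2d_pt Q x y.
Proof.
intros [k [l [m [HP HQ]]]]; split; apply differentiable_continuity_pt.
- now exists k, l.
- now exists l, m.
Qed.

(** The bound eps s^2 on the circulation is proportional to the area, hence
    additive over the four quarters, and [circulation_closed_small] provides it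
    on small rectangles. *)
Theorem Goursat (P Q : R -> R -> R) (x0 y0 a b : R) :
  0 < a -> 0 < b ->
  (forall x y, x0 <= x <= x0 + a -> y0 <= y <= y0 + b -> closed_at P Q x y) ->
  circulation P Q x0 y0 a b = 0.
Proof.
intros Ha Hb Hcl.
assert (Hcont : forall x y, x0 <= x <= x0 + a -> y0 <= y <= y0 + b ->
   continuity_2d_pt P x y /\ continuity_2d_pt Q x y)
  by (intros; apply closed_at_continuity; auto).
assert (Hmain : forall eps, 0 < eps -> Rabs (circulation P Q x0 y0 a b) <= eps).
{ intros eps Heps.
  enough (x0 <= x0 -> x0 + 1 * a <= x0 + a -> y0 <= y0 -> y0 + 1 * b <= y0 + b ->
     Rabs (circulation P Q x0 y0 (1 * a) (1 * b)) <= eps * 1 ^ 2) as H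
    by (rewrite !Rmult_1_l, pow1, Rmult_1_r in H; apply H; lra).
  apply (rectangle_bisection (fun x y s =>
    x0 <= x -> x + s * a <= x0 + a -> y0 <= y -> y + s * b <= y0 + b ->
    Rabs (circulation P Q x y (s * a) (s * b)) <= eps * s ^ 2) x0 y0 a b); auto.
  - intros x y s Hs H1 H2 H3 H4 I1 I2 I3 I4.
    assert (0 < s / 2 * a /\ 0 < s / 2 * b) as [Hsa Hsb]
      by (split; apply Rmult_lt_0_compat; lra).
    replace (s * a) with (s / 2 * a + s / 2 * a) in * by field.
    replace (s * b) with (s / 2 * b + s / 2 * b) in * by field.
    rewrite circulation_split_width by (try lra; intros; apply Hcont; lra).
    rewrite !circulation_split_height by (try lra; intros; apply Hcont; lra).
    specialize (H1 ltac:(lra) ltac:(lra) ltac:(lra) ltac:(lra)).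
    specialize (H2 ltac:(lra) ltac:(lra) ltac:(lra) ltac:(lra)).
    specialize (H3 ltac:(lra) ltac:(lra) ltac:(lra) ltac:(lra)).
    specialize (H4 ltac:(lra) ltac:(lra) ltac:(lra) ltac:(lra)).
    apply Rabs_le_between in H1, H2, H3, H4; apply Rabs_le.
    replace (eps * s ^ 2) with (4 * (eps * (s / 2) ^ 2)) by field; lra.
  - intros p q Hp Hq.
    destruct (circulation_closed_small P Q p q (eps / (4 * (a + b) ^ 2)))
      as [delta [Hdelta H]]; auto.
    { apply Rdiv_lt_0_compat; auto; nra. }
    exists (delta / (a + b)); split; [apply Rdiv_lt_0_compat; lra|].
    intros x y s Hs Hx Hy I1 I2 I3 I4.
    assert (s * (a + b) < delta).
    { replace delta with (delta / (a + b) * (a + b)) by (field; lra).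
      apply Rmult_lt_compat_r; lra. }
    assert (0 < s * a /\ 0 < s * b) as [Hsa Hsb]
      by (split; apply Rmult_lt_0_compat; lra).
    replace (eps * s ^ 2) with (4 * (eps / (4 * (a + b) ^ 2)) * (s * (a + b)) ^ 2)
      by (field; lra).
    apply H; try lra; intros; apply Hcont; lra. }
apply Rabs_eq_0, Rle_antisym; [|apply Rabs_pos].
apply le_epsilon; intros eps Heps; rewrite Rplus_0_l; auto.
Qed.

(** * The mean value property *)

(** The Cauchy-Riemann equations at a point, with alpha + i beta as the complex
    derivative of U + i V. *)
Definition CR_at (U V : R -> R -> R) (x y : R) : Prop :=
  exists alpha beta,
    differentiable_pt_lim U x y alpha (- beta) /\
    differentiable_pt_lim V x y beta alpha.

(** The upper bound is written [0 + 2 * PI] to have the form (start + length) of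
    the sides of a rectangle in [circulation]. *)
Definition circle_integral (U : R -> R -> R) (a b r : R) : R :=
  RInt (fun t => U (a + r * cos t) (b + r * sin t)) 0 (0 + 2 * PI).

Lemma differentiable_pt_lim_mult (x y : R) :
  differentiable_pt_lim (fun u v => u * v) x y y x.
Proof.
intros eps; exists eps; intros u v Hu Hv.
replace (u * v - x * y - (y * (u - x) + x * (v - y))) with ((u - x) * (v - y)) by ring.
rewrite Rabs_mult; apply Rmult_le_compat; try apply Rabs_pos; [lra|apply Rmax_r].
Qed.

Lemma differentiable_pt_lim_snd (f : R -> R) (x y l : R) :
  derivable_pt_lim f y l -> differentiable_pt_lim (fun _ v => f v) x y 0 l.
Proof.
intros H eps; destruct (differentiable_pt_lim_proj1_0 f y x l H eps) as [d Hd].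
exists d; intros u v Hu Hv; specialize (Hd v u Hv Hu).
rewrite Rmax_comm.
replace (f v - f y - (0 * (u - x) + l * (v - y)))
  with (f v - f y - (l * (v - y) + 0 * (u - x))) by ring.
exact Hd.
Qed.

Lemma differentiable_pt_lim_affine_prod (a : R) (f : R -> R) (x y l : R) :
  derivable_pt_lim f y l ->
  differentiable_pt_lim (fun u v => a + u * f v) x y (f y) (x * l).
Proof.
intros H.
pose proof (differentiable_pt_lim_comp (fun u v => u * v) (fun u _ => u) (fun _ v => f v)
  x y _ _ _ _ _ _ (differentiable_pt_lim_mult x (f y))
  (differentiable_pt_lim_proj1_0 _ x y 1 (derivable_pt_lim_id x))
  (differentiable_pt_lim_snd f x y l H)) as H1.
intros eps; destruct (H1 eps) as [d Hd]; exists d; intros u v Hu Hv.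
specialize (Hd u v Hu Hv).
replace (a + u * f v - (a + x * f y) - (f y * (u - x) + x * l * (v - y)))
 with (u * f v - x * f y -
      ((f y * 1 + x * 0) * (u - x) + (f y * 0 + x * l) * (v - y))) by ring.
exact Hd.
Qed.

(** The form is the imaginary part of (U + i V) dz / (z - c) with
    c = a + i b, in polar coordinates about c. *)
Lemma polar_closed_at (U V : R -> R -> R) (a b r t : R) :
  0 < r -> CR_at U V (a + r * cos t) (b + r * sin t) ->
  closed_at (fun r t => / r * V (a + r * cos t) (b + r * sin t))
            (fun r t => U (a + r * cos t) (b + r * sin t)) r t.
Proof.
intros Hr [al [be [HU HV]]].
pose proof (differentiable_pt_lim_affine_prod a cos r t _ (derivable_pt_lim_cos t)) as Hc.
pose proof (differentiable_pt_lim_affine_prod b sin r t _ (derivable_pt_lim_sin t)) as Hs.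
pose proof (differentiable_pt_lim_comp _ _ _ _ _ _ _ _ _ _ _ HU Hc Hs) as HU'.
pose proof (differentiable_pt_lim_comp _ _ _ _ _ _ _ _ _ _ _ HV Hc Hs) as HV'.
assert (Hi : derivable_pt_lim Rinv r (- / r ^ 2)).
{ apply is_derive_Reals; auto_derive; [lra|field; lra]. }
pose proof (differentiable_pt_lim_comp (fun u v => u * v) _ _ _ _ _ _ _ _ _ _
  (differentiable_pt_lim_mult _ _) (differentiable_pt_lim_proj1_0 _ r t _ Hi) HV') as HP.
cbv beta in HP.
match type of HP with differentiable_pt_lim _ _ _ _ ?l =>
  replace l with (al * cos t + - be * sin t) in HP by (field; lra) end.
eexists; exists (al * cos t + - be * sin t); eexists; split; [exact HP|exact HU'].
Qed.

Lemma polar_dist (a b r t : R) :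
  (a + r * cos t - a) ^ 2 + (b + r * sin t - b) ^ 2 = r ^ 2.
Proof.
pose proof (sin2_cos2 t) as H; unfold Rsqr in H.
replace ((a + r * cos t - a) ^ 2 + (b + r * sin t - b) ^ 2)
  with (r ^ 2 * (sin t * sin t + cos t * cos t)) by ring.
rewrite H; ring.
Qed.

(** [Goursat] on the rectangle [r1, r2] x [0, 2 pi]: the two sides on which the
    angle is constant cancel because the form is periodic in the angle. *)
Lemma circle_integral_constant (U V : R -> R -> R) (a b rho r1 r2 : R) :
  (forall x y, 0 < (x - a) ^ 2 + (y - b) ^ 2 < rho ^ 2 -> CR_at U V x y) ->
  0 < r1 <= r2 -> r2 < rho ->
  circle_integral U a b r1 = circle_integral U a b r2.
Proof.
intros H Hr Hr2; destruct (proj2 Hr) as [Hlt| ->]; [|reflexivity].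
pose (P := fun r t => / r * V (a + r * cos t) (b + r * sin t)).
pose (Q := fun r t => U (a + r * cos t) (b + r * sin t)).
pose proof PI_RGT_0 as Hpi.
assert (Hcl : forall r t, r1 <= r <= r2 -> closed_at P Q r t).
{ intros r t Hrt; apply polar_closed_at; [lra|]; apply H; rewrite polar_dist; nra. }
assert (HG : circulation P Q r1 0 (r2 - r1) (2 * PI) = 0)
  by (apply Goursat; try lra; intros; apply Hcl; lra).
rewrite circulation_sides in HG; try lra.
2:{ intros; apply (closed_at_continuity P Q), Hcl; lra. }
replace (r1 + (r2 - r1)) with r2 in HG by ring.
assert (HPp : RInt (fun t => P t (0 + 2 * PI)) r1 r2 = RInt (fun t => P t 0) r1 r2).
{ apply RInt_ext; intros r _; unfold P.
  rewrite Rplus_0_l, cos_2PI, sin_2PI, cos_0, sin_0; reflexivity. }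
change (circle_integral U a b r1) with (RInt (fun t => Q r1 t) 0 (0 + 2 * PI)).
change (circle_integral U a b r2) with (RInt (fun t => Q r2 t) 0 (0 + 2 * PI)).
lra.
Qed.

Lemma circle_continuous (U : R -> R -> R) (a b r t : R) :
  continuity_2d_pt U (a + r * cos t) (b + r * sin t) ->
  continuous (fun t => U (a + r * cos t) (b + r * sin t)) t.
Proof.
intros H.
apply (continuous_comp_2 (fun t => a + r * cos t) (fun t => b + r * sin t) U).
- apply (@ex_derive_continuous R_AbsRing R_NormedModule); auto_derive; auto.
- apply (@ex_derive_continuous R_AbsRing R_NormedModule); auto_derive; auto.
- now apply continuity_2d_pt_filterlim.
Qed.

Lemma circle_ex_RInt (U : R -> R -> R) (a b r : R) :
  (forall x y, (x - a) ^ 2 + (y - b) ^ 2 = r ^ 2 -> continuity_2d_pt U x y) ->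
  ex_RInt (fun t => U (a + r * cos t) (b + r * sin t)) 0 (0 + 2 * PI).
Proof.
intros H; apply (@ex_RInt_continuous R_CompleteNormedModule); intros t _.
apply circle_continuous, H, polar_dist.
Qed.

(** The circle can be shrunk to the centre, where continuity of U is enough. *)
Theorem mean_value (U V : R -> R -> R) (a b rho r : R) :
  (forall x y, 0 < (x - a) ^ 2 + (y - b) ^ 2 < rho ^ 2 -> CR_at U V x y) ->
  continuity_2d_pt U a b -> 0 < r < rho ->
  circle_integral U a b r = 2 * PI * U a b.
Proof.
intros H Hc Hr; pose proof PI_RGT_0 as Hpi.
apply Rminus_diag_uniq, Rabs_eq_0, Rle_antisym; [|apply Rabs_pos].
apply le_epsilon; intros eps Heps; rewrite Rplus_0_l.
assert (He : 0 < eps / (2 * PI)) by (apply Rdiv_lt_0_compat; lra).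
destruct (Hc (mkposreal _ He)) as [d Hd]; simpl in Hd.
pose proof (cond_pos d) as Hdp.
pose (s := Rmin (d / 2) r).
assert (Hs : 0 < s) by (apply Rmin_pos; lra).
assert (s <= d / 2 /\ s <= r) as [Hs1 Hs2] by (split; [apply Rmin_l|apply Rmin_r]).
rewrite <- (circle_integral_constant U V a b rho s r) by (auto; lra).
replace eps with (2 * PI * (eps / (2 * PI))) by (field; lra).
apply RInt_near_const; [lra| |].
- apply circle_ex_RInt; intros x y Hxy.
  assert (HCR : CR_at U V x y) by (apply H; nra).
  destruct HCR as [al [be [HU _]]].
  apply differentiable_continuity_pt; now exists al, (- be).
- intros t _; apply Rlt_le, Hd.
  + replace (a + s * cos t - a) with (s * cos t) by ring.
    rewrite Rabs_mult, (Rabs_right s) by lra.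
    pose proof (COS_bound t); assert (Rabs (cos t) <= 1) by (apply Rabs_le; lra); nra.
  + replace (b + s * sin t - b) with (s * sin t) by ring.
    rewrite Rabs_mult, (Rabs_right s) by lra.
    pose proof (SIN_bound t); assert (Rabs (sin t) <= 1) by (apply Rabs_le; lra); nra.
Qed.

(** * The maximum principle *)

(** If no point were a maximum, each small rectangle would be dominated by the
    value at some point of the large one; domination passes from quarters to the whole
    by taking the best of the four points, and the whole rectangle cannot be
    dominated by one of its own points. *)
Lemma rectangle_maximum (phi : R -> R -> R) (x0 y0 a b : R) :
  0 < a -> 0 < b ->
  (forall x y, x0 <= x <= x0 + a -> y0 <= y <= y0 + b -> continuity_2d_pt phi x y) ->
  exists p q, x0 <= p <= x0 + a /\ y0 <= q <= y0 + b /\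
    forall x y, x0 <= x <= x0 + a -> y0 <= y <= y0 + b -> phi x y <= phi p q.
Proof.
intros Ha Hb Hc; apply NNPP; intros Hno.
pose (inR := fun x y => x0 <= x <= x0 + a /\ y0 <= y <= y0 + b).
assert (Hup : forall p q, inR p q -> exists p' q', inR p' q' /\ phi p q < phi p' q').
{ intros p q [Hp Hq]; apply NNPP; intros H; apply Hno; exists p, q; repeat split; try lra.
  intros x y Hx Hy; apply Rnot_lt_le; intros Hlt; apply H; exists x, y.
  unfold inR; tauto. }
assert (Hmax : forall p q p' q', inR p q -> inR p' q' ->
   exists p'' q'', inR p'' q'' /\ phi p q <= phi p'' q'' /\ phi p' q' <= phi p'' q'').
{ intros p q p' q' H H'; destruct (Rle_lt_dec (phi p q) (phi p' q')).
  - exists p', q'; repeat split; try apply H'; lra.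
  - exists p, q; repeat split; try apply H; lra. }
pose (P := fun x y s => exists p q, inR p q /\ forall u v,
   x <= u <= x + s * a -> y <= v <= y + s * b -> inR u v -> phi u v < phi p q).
assert (HP : P x0 y0 1).
{ apply (rectangle_bisection P x0 y0 a b); auto.
  - intros x y s Hs [p1 [q1 [I1 H1]]] [p2 [q2 [I2 H2]]] [p3 [q3 [I3 H3]]] [p4 [q4 [I4 H4]]].
    destruct (Hmax _ _ _ _ I1 I2) as [p5 [q5 [I5 [J1 J2]]]].
    destruct (Hmax _ _ _ _ I3 I4) as [p6 [q6 [I6 [J3 J4]]]].
    destruct (Hmax _ _ _ _ I5 I6) as [p [q [I [J5 J6]]]].
    exists p, q; split; auto; intros u v Hu Hv HI.
    destruct (Rle_lt_dec u (x + s / 2 * a)), (Rle_lt_dec v (y + s / 2 * b)).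
    + specialize (H1 u v ltac:(lra) ltac:(lra) HI); lra.
    + specialize (H3 u v ltac:(lra) ltac:(lra) HI); lra.
    + specialize (H2 u v ltac:(lra) ltac:(lra) HI); lra.
    + specialize (H4 u v ltac:(lra) ltac:(lra) HI); lra.
  - intros p q Hp Hq; destruct (Hup p q (conj Hp Hq)) as [p' [q' [I' Hlt]]].
    assert (He : 0 < phi p' q' - phi p q) by lra.
    destruct (Hc p q Hp Hq (mkposreal _ He)) as [d Hd]; simpl in Hd.
    exists (d / (a + b)); split; [apply Rdiv_lt_0_compat; [apply cond_pos|lra]|].
    intros x y s Hs Hx Hy; exists p', q'; split; auto; intros u v Hu Hv _.
    assert (s * (a + b) < d).
    { replace (pos d) with (d / (a + b) * (a + b)) by (field; lra).
      apply Rmult_lt_compat_r; lra. }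
    assert (0 < s * a /\ 0 < s * b) as [Hsa Hsb]
      by (split; apply Rmult_lt_0_compat; lra).
    assert (Hn : Rabs (phi u v - phi p q) < phi p' q' - phi p q)
      by (apply Hd; apply Rabs_def1; lra).
    apply Rabs_def2 in Hn; lra. }
destruct HP as [p [q [I H]]].
destruct I as [Hp Hq]; specialize (H p q ltac:(lra) ltac:(lra) (conj Hp Hq)); lra.
Qed.

Definition has_local_mean_value (U : R -> R -> R) (x y : R) : Prop :=
  exists delta, 0 < delta /\
    forall r, 0 < r < delta -> circle_integral U x y r = 2 * PI * U x y.

Lemma circle_integral_quadratic (a b x y r : R) :
  is_RInt (fun t => (x + r * cos t - a) ^ 2 + (y + r * sin t - b) ^ 2) 0 (0 + 2 * PI)
    (2 * PI * ((x - a) ^ 2 + (y - b) ^ 2 + r ^ 2)).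
Proof.
pose (F := fun t => ((x - a) ^ 2 + (y - b) ^ 2 + r ^ 2) * t
                    + 2 * (x - a) * r * sin t - 2 * (y - b) * r * cos t).
assert (E : 2 * PI * ((x - a) ^ 2 + (y - b) ^ 2 + r ^ 2) = F (0 + 2 * PI) - F 0).
{ unfold F; rewrite Rplus_0_l, sin_2PI, cos_2PI, sin_0, cos_0; ring. }
rewrite E.
apply (@is_RInt_derive R_CompleteNormedModule).
- intros t _; unfold F; auto_derive; auto.
  pose proof (sin2_cos2 t) as H; unfold Rsqr in H.
  replace ((x + r * cos t - a) ^ 2 + (y + r * sin t - b) ^ 2) with
   ((x - a) ^ 2 + (y - b) ^ 2 + r ^ 2 * (sin t * sin t + cos t * cos t)
    + 2 * (x - a) * r * cos t + 2 * (y - b) * r * sin t) by ring.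
  rewrite H; ring.
- intros t _; apply (@ex_derive_continuous R_AbsRing R_NormedModule); auto_derive; auto.
Qed.

Lemma Rmax_le_square (a b rho x y : R) :
  Rmax (Rabs (x - a)) (Rabs (y - b)) <= rho <->
  a - rho <= x <= a + rho /\ b - rho <= y <= b + rho.
Proof.
split.
- intros H; pose proof (Rmax_l (Rabs (x - a)) (Rabs (y - b))) as H1.
  pose proof (Rmax_r (Rabs (x - a)) (Rabs (y - b))) as H2.
  assert (H3 : Rabs (x - a) <= rho) by lra; assert (H4 : Rabs (y - b) <= rho) by lra.
  apply Rabs_le_between in H3, H4; lra.
- intros H; apply Rmax_lub; apply Rabs_le; lra.
Qed.

(** Adding the small multiple eps of the squared distance to the centre makes U
    strictly subharmonic: the mean over a circle of radius r exceeds the value at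
    its centre by eps r^2, which excludes an interior maximum. *)
Theorem maximum_principle (U : R -> R -> R) (a b rho B : R) :
  0 < rho ->
  (forall x y, Rmax (Rabs (x - a)) (Rabs (y - b)) <= rho -> continuity_2d_pt U x y) ->
  (forall x y, Rmax (Rabs (x - a)) (Rabs (y - b)) < rho -> has_local_mean_value U x y) ->
  (forall x y, Rmax (Rabs (x - a)) (Rabs (y - b)) = rho -> U x y <= B) ->
  forall x y, Rmax (Rabs (x - a)) (Rabs (y - b)) <= rho -> U x y <= B.
Proof.
intros Hrho Hc Hm HB x y Hxy; apply Rnot_lt_le; intros Hlt.
pose (N := fun u v => (u - a) ^ 2 + (v - b) ^ 2).
(* phi - U is at most 2 eps rho^2 on the square, half of the excess of U at (x, y). *)
pose (eps := (U x y - B) / (4 * rho ^ 2)).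
assert (Heps : 0 < eps) by (apply Rdiv_lt_0_compat; nra).
pose (phi := fun u v => U u v + eps * N u v).
assert (HcN : forall u v, continuity_2d_pt (fun u v => eps * N u v) u v).
{ intros u v; unfold N; simpl.
  repeat first [apply continuity_2d_pt_plus | apply continuity_2d_pt_mult
    | apply continuity_2d_pt_minus | apply continuity_2d_pt_const
    | apply continuity_2d_pt_id1 | apply continuity_2d_pt_id2]. }
assert (Hcphi : forall u v, Rmax (Rabs (u - a)) (Rabs (v - b)) <= rho ->
          continuity_2d_pt phi u v)
  by (intros u v H; apply continuity_2d_pt_plus; auto).
destruct (rectangle_maximum phi (a - rho) (b - rho) (2 * rho) (2 * rho))
  as [p [q [Hp [Hq Hpq]]]]; try lra.
{ intros u v Hu Hv; apply Hcphi, Rmax_le_square; lra. }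
assert (Hmax : forall u v, Rmax (Rabs (u - a)) (Rabs (v - b)) <= rho -> phi u v <= phi p q)
  by (intros u v H; apply Rmax_le_square in H; apply Hpq; lra).
assert (HI : Rmax (Rabs (p - a)) (Rabs (q - b)) <= rho) by (apply Rmax_le_square; lra).
destruct HI as [HI|HI].
- destruct (Hm p q HI) as [d [Hd HI']].
  set (m := rho - Rmax (Rabs (p - a)) (Rabs (q - b))).
  assert (Hm0 : 0 < m) by (unfold m; lra).
  pose (r := Rmin (d / 2) m).
  assert (Hr : 0 < r) by (apply Rmin_pos; lra).
  assert (r <= d / 2 /\ r <= m) as [Hr1 Hr2] by (split; [apply Rmin_l|apply Rmin_r]).
  assert (Hin : forall t, Rmax (Rabs (p + r * cos t - a)) (Rabs (q + r * sin t - b)) <= rho).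
  { intros t; pose proof (Rmax_l (Rabs (p - a)) (Rabs (q - b))) as H1.
    pose proof (Rmax_r (Rabs (p - a)) (Rabs (q - b))) as H2.
    assert (Rabs (r * cos t) <= r /\ Rabs (r * sin t) <= r) as [H3 H4].
    { rewrite !Rabs_mult, (Rabs_right r) by lra.
      pose proof (SIN_bound t); pose proof (COS_bound t).
      assert (Rabs (cos t) <= 1) by (apply Rabs_le; lra).
      assert (Rabs (sin t) <= 1) by (apply Rabs_le; lra); split; nra. }
    pose proof (Rabs_triang (p - a) (r * cos t)); pose proof (Rabs_triang (q - b) (r * sin t)).
    apply Rmax_lub.
    - replace (p + r * cos t - a) with (p - a + r * cos t) by ring; unfold m in *; lra.
    - replace (q + r * sin t - b) with (q - b + r * sin t) by ring; unfold m in *; lra. }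
  pose proof PI_RGT_0 as Hpi.
  assert (EU : ex_RInt (fun t => U (p + r * cos t) (q + r * sin t)) 0 (0 + 2 * PI)).
  { apply (@ex_RInt_continuous R_CompleteNormedModule); intros t _.
    apply circle_continuous, Hc, Hin. }
  pose proof (is_RInt_plus _ _ _ _ _ _ (RInt_correct _ _ _ EU)
     (is_RInt_scal _ _ _ eps _ (circle_integral_quadratic a b p q r))) as E.
  apply is_RInt_unique in E.
  assert (E2 : RInt (fun t => phi (p + r * cos t) (q + r * sin t)) 0 (0 + 2 * PI)
     = 2 * PI * U p q + eps * (2 * PI * (N p q + r ^ 2))).
  { etransitivity; [exact E|]; rewrite <- (HI' r) by lra; reflexivity. }
  assert (E3 : RInt (fun t => phi (p + r * cos t) (q + r * sin t)) 0 (0 + 2 * PI)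
     <= RInt (fun _ => phi p q) 0 (0 + 2 * PI)).
  { apply RInt_le; [lra| |apply ex_RInt_const|intros; apply Hmax, Hin].
    apply (@ex_RInt_continuous R_CompleteNormedModule); intros t _.
    apply circle_continuous, Hcphi, Hin. }
  rewrite (RInt_const 0 (0 + 2 * PI) (phi p q)) in E3.
  change (scal (0 + 2 * PI - 0) (phi p q)) with ((0 + 2 * PI - 0) * phi p q) in E3.
  unfold phi at 2 in E3; rewrite E2 in E3.
  assert (Hr0 : 0 < r ^ 2) by (apply pow_lt; lra).
  assert (0 < eps * (2 * PI * r ^ 2)).
  { apply Rmult_lt_0_compat; [lra|]; apply Rmult_lt_0_compat; lra. }
  lra.
- specialize (HB p q HI); specialize (Hmax x y Hxy); unfold phi in Hmax.
  assert (HN : N p q <= 2 * rho ^ 2) by (unfold N; nra).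
  assert (0 <= eps * N x y)
    by (apply Rmult_le_pos; [lra|apply Rplus_le_le_0_compat; apply pow2_ge_0]).
  assert (eps * N p q <= eps * (2 * rho ^ 2)) by (apply Rmult_le_compat_l; lra).
  assert (eps * (2 * rho ^ 2) = (U x y - B) / 2) by (unfold eps; field; lra).
  lra.
Qed.

(** * Complex derivatives *)

Notation is_C_derive f z l := (is_derive (K := C_AbsRing) (V := C_NormedModule) f z l).

Lemma is_C_derive_iff (f : C -> C) (z l : C) :
  is_C_derive f z l <->
  forall eps, 0 < eps -> exists delta, 0 < delta /\
    forall w, Cmod (w - z) < delta ->
      Cmod (f w - f z - l * (w - z))%C <= eps * Cmod (w - z)%C.
Proof.
split.
- intros [_ H] eps Heps.
  destruct (H z (fun P HP => HP) (mkposreal eps Heps)) as [d Hd].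
  exists d; split; [apply cond_pos|]; intros w Hw; specialize (Hd w Hw).
  rewrite (Cmult_comm l); exact Hd.
- intros H; split.
  + apply (@is_linear_scal_l C_AbsRing C_NormedModule).
  + intros x Hx eps.
    rewrite <- (@is_filter_lim_locally_unique C_AbsRing (AbsRing_NormedModule C_AbsRing) _ _ Hx).
    destruct (H eps (cond_pos eps)) as [d [Hd Hd']].
    exists (mkposreal d Hd); intros w Hw; specialize (Hd' w Hw).
    rewrite (Cmult_comm l) in Hd'; exact Hd'.
Qed.

(** C carries two normed module structures over itself, with different balls but
    the same norm, so the domination clause of the derivative is the same for both
    and the product rule in the ring C can be transferred. *)
Lemma is_C_derive_mult (f g : C -> C) (z df dg : C) :
  is_C_derive f z df -> is_C_derive g z dg ->
  is_C_derive (fun w => f w * g w)%C z (df * g z + f z * dg)%C.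
Proof.
intros [_ Hf] [_ Hg].
destruct (is_derive_mult (K := C_AbsRing) f g z df dg) as [_ H].
- split; [apply (@is_linear_scal_l C_AbsRing (AbsRing_NormedModule C_AbsRing))|exact Hf].
- split; [apply (@is_linear_scal_l C_AbsRing (AbsRing_NormedModule C_AbsRing))|exact Hg].
- exact Cmult_comm.
- split; [apply (@is_linear_scal_l C_AbsRing C_NormedModule)|exact H].
Qed.

Lemma is_C_derive_inv (a z : C) :
  z <> a -> is_C_derive (fun w => / (w - a))%C z (- / ((z - a) * (z - a)))%C.
Proof.
intros Hza; apply is_C_derive_iff; intros eps Heps.
assert (Hz : (z - a)%C <> 0%C) by (intros E; apply Hza; replace z with (z - a + a)%C by ring;
  rewrite E; ring).
set (m := Cmod (z - a)); assert (Hm : 0 < m) by now apply Cmod_gt_0.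
exists (Rmin (m / 2) (eps * (m ^ 3 / 2))); split.
{ apply Rmin_pos; [lra|]; apply Rmult_lt_0_compat; [lra|].
  apply Rdiv_lt_0_compat; [apply pow_lt|]; lra. }
intros w Hw.
pose proof (Rmin_l (m / 2) (eps * (m ^ 3 / 2))); pose proof (Rmin_r (m / 2) (eps * (m ^ 3 / 2))).
assert (Hwa : m / 2 <= Cmod (w - a)).
{ pose proof (Cmod_triangle (w - a) (- (w - z))) as Ht.
  replace (w - a + - (w - z))%C with (z - a)%C in Ht by ring; rewrite Cmod_opp in Ht.
  fold m in Ht; lra. }
assert (Hw0 : (w - a)%C <> 0%C) by (apply Cmod_gt_0; lra).
replace (/ (w - a) - / (z - a) - - / ((z - a) * (z - a)) * (w - z))%C
  with ((w - z) * ((w - z) / ((z - a) * (z - a) * (w - a))))%C by (field; auto).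
rewrite Cmod_mult, Rmult_comm; apply Rmult_le_compat_r; [apply Cmod_ge_0|].
rewrite Cmod_div by (repeat apply Cmult_neq_0; auto).
rewrite !Cmod_mult; fold m.
apply Rle_div_l; [repeat apply Rmult_lt_0_compat; lra|].
apply Rle_trans with (eps * (m * m * (m / 2))).
- replace (m * m * (m / 2)) with (m ^ 3 / 2) by field; lra.
- apply Rmult_le_compat_l; [lra|]; apply Rmult_le_compat_l; [nra|lra].
Qed.

Lemma Rabs_Im_le_Cmod (c : C) : Rabs (Im c) <= Cmod c.
Proof. eapply Rle_trans; [apply Rmax_r|apply Rmax_Cmod]. Qed.

Lemma is_C_derive_CR (f : C -> C) (x y : R) (l : C) :
  is_C_derive f (x, y) l ->
  CR_at (fun x y => Re (f (x, y))) (fun x y => Im (f (x, y))) x y.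
Proof.
intros H; exists (Re l), (Im l).
assert (Hs : 0 < sqrt 2) by (apply sqrt_lt_R0; lra).
assert (Hb : forall eps : posreal, exists d : posreal, forall u v,
  Rabs (u - x) < d -> Rabs (v - y) < d ->
  Cmod (f (u, v) - f (x, y) - l * ((u, v) - (x, y)))%C
    <= eps * Rmax (Rabs (u - x)) (Rabs (v - y))).
{ intros eps.
  destruct (proj1 (is_C_derive_iff _ _ _) H (eps / sqrt 2)) as [d [Hd Hf]].
  { apply Rdiv_lt_0_compat; [apply cond_pos|auto]. }
  assert (Hd' : 0 < d / sqrt 2) by now apply Rdiv_lt_0_compat.
  exists (mkposreal _ Hd'); simpl; intros u v Hu Hv.
  assert (Hle := Cmod_2Rmax ((u, v) - (x, y))%C); simpl in Hle.
  change (u + - x) with (u - x) in Hle; change (v + - y) with (v - y) in Hle.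
  eapply Rle_trans.
  - apply Hf; eapply Rle_lt_trans; [exact Hle|].
    replace d with (sqrt 2 * (d / sqrt 2)) by (field; lra).
    apply Rmult_lt_compat_l; [lra|]; now apply Rmax_lub_lt.
  - replace (eps * Rmax (Rabs (u - x)) (Rabs (v - y)))
      with (eps / sqrt 2 * (sqrt 2 * Rmax (Rabs (u - x)) (Rabs (v - y)))) by (field; lra).
    apply Rmult_le_compat_l; auto; apply Rlt_le, Rdiv_lt_0_compat; [apply cond_pos|auto]. }
split; intros eps; destruct (Hb eps) as [d Hd]; exists d; intros u v Hu Hv;
  specialize (Hd u v Hu Hv); eapply Rle_trans; try exact Hd.
- eapply Rle_trans; [|apply re_le_Cmod]; right; f_equal; unfold Re, Im; simpl; unfold Im; ring.
- eapply Rle_trans; [|apply Rabs_Im_le_Cmod]; right; f_equal; unfold Re, Im; simpl; unfold Re; ring.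
Qed.

(** * The difference quotient of a bounded holomorphic function *)

Definition C_continuous_at (g : C -> C) (z : C) : Prop :=
  forall eps, 0 < eps -> exists delta, 0 < delta /\
    forall w, Cmod (w - z) < delta -> Cmod (g w - g z) < eps.

Lemma is_C_derive_continuous (g : C -> C) (z l : C) :
  is_C_derive g z l -> C_continuous_at g z.
Proof.
intros H eps Heps.
destruct (proj1 (is_C_derive_iff _ _ _) H 1 Rlt_0_1) as [d [Hd Hg]].
pose proof (Cmod_ge_0 l) as Hl.
assert (Hq : 0 < eps / (1 + Cmod l)) by (apply Rdiv_lt_0_compat; lra).
exists (Rmin d (eps / (1 + Cmod l))); split; [now apply Rmin_pos|].
intros w Hw.
pose proof (Rmin_l d (eps / (1 + Cmod l))); pose proof (Rmin_r d (eps / (1 + Cmod l))).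
specialize (Hg w ltac:(lra)).
pose proof (Cmod_triangle (g w - g z - l * (w - z)) (l * (w - z))) as Ht.
replace (g w - g z - l * (w - z) + l * (w - z))%C with (g w - g z)%C in Ht by ring.
rewrite Cmod_mult in Ht.
assert ((1 + Cmod l) * Cmod (w - z) < (1 + Cmod l) * (eps / (1 + Cmod l)))
  by (apply Rmult_lt_compat_l; lra).
replace ((1 + Cmod l) * (eps / (1 + Cmod l))) with eps in * by (field; lra).
lra.
Qed.

Lemma C_continuous_Re (g : C -> C) (x y : R) :
  C_continuous_at g (x, y) -> continuity_2d_pt (fun x y => Re (g (x, y))) x y.
Proof.
intros H eps; destruct (H eps (cond_pos eps)) as [d [Hd Hg]].
assert (Hs : 0 < sqrt 2) by (apply sqrt_lt_R0; lra).
assert (Hd' : 0 < d / sqrt 2) by now apply Rdiv_lt_0_compat.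
exists (mkposreal _ Hd'); simpl; intros u v Hu Hv.
eapply Rle_lt_trans; [|apply (Hg (u, v))].
- exact (re_le_Cmod (g (u, v) - g (x, y))%C).
- eapply Rle_lt_trans; [apply Cmod_2Rmax|].
  replace d with (sqrt 2 * (d / sqrt 2)) by (field; lra).
  apply Rmult_lt_compat_l; [lra|]; now apply Rmax_lub_lt.
Qed.

Lemma C_continuous_scal (g : C -> C) (c z : C) :
  C_continuous_at g z -> C_continuous_at (fun w => c * g w)%C z.
Proof.
intros H eps Heps; pose proof (Cmod_ge_0 c) as Hc.
destruct (H (eps / (1 + Cmod c))) as [d [Hd Hg]]; [apply Rdiv_lt_0_compat; lra|].
exists d; split; auto; intros w Hw; specialize (Hg w Hw).
replace (c * g w - c * g z)%C with (c * (g w - g z))%C by ring; rewrite Cmod_mult.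
pose proof (Cmod_ge_0 (g w - g z)) as Hge.
apply Rle_lt_trans with ((1 + Cmod c) * Cmod (g w - g z)); [nra|].
replace eps with ((1 + Cmod c) * (eps / (1 + Cmod c))) by (field; lra).
apply Rmult_lt_compat_l; lra.
Qed.

Lemma Cmod_pair_sqr (x y a b : R) :
  Cmod ((x, y) - (a, b)) ^ 2 = (x - a) ^ 2 + (y - b) ^ 2.
Proof. rewrite Cmod2_alt; unfold Re, Im; simpl; ring. Qed.

Lemma local_mean_value_Re (g : C -> C) (x y delta : R) :
  0 < delta -> C_continuous_at g (x, y) ->
  (forall z, 0 < Cmod (z - (x, y)) < delta -> exists l, is_C_derive g z l) ->
  has_local_mean_value (fun x y => Re (g (x, y))) x y.
Proof.
intros Hd Hc H; exists delta; split; auto; intros r Hr.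
apply (mean_value (fun x y => Re (g (x, y))) (fun x y => Im (g (x, y))) x y delta); auto.
- intros u v Huv; rewrite <- (Cmod_pair_sqr u v x y) in Huv.
  pose proof (Cmod_ge_0 ((u, v) - (x, y))).
  destruct (H (u, v)) as [l Hl]; [nra|].
  now apply (is_C_derive_CR g u v l).
- now apply C_continuous_Re.
Qed.

(** Squares, rather than discs, are the natural compact sets for the bisection
    argument. *)
Definition square_dist (z a : C) : R := Rmax (Rabs (Re z - Re a)) (Rabs (Im z - Im a)).

(** The maximum principle for the real part of c g, where c of modulus 1 turns
    g z into its modulus.  Differentiability is asked in punctured neighbourhoods only,
    so that difference quotients qualify. *)
Theorem maximum_modulus (g : C -> C) (a : C) (rho B : R) :
  0 < rho ->
  (forall z, square_dist z a <= rho -> C_continuous_at g z) ->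
  (forall z, square_dist z a < rho -> exists delta, 0 < delta /\
     forall w, 0 < Cmod (w - z) < delta -> exists l, is_C_derive g w l) ->
  (forall z, square_dist z a = rho -> Cmod (g z) <= B) ->
  forall z, square_dist z a <= rho -> Cmod (g z) <= B.
Proof.
intros Hrho Hc Hd HB z Hz; apply Rnot_lt_le; intros Hlt.
assert (HB0 : 0 <= B).
{ eapply Rle_trans; [apply Cmod_ge_0|apply (HB (Re a + rho, Im a))].
  unfold square_dist; simpl; replace (Re a + rho - Re a) with rho by ring.
  rewrite Rminus_diag, Rabs_R0, Rabs_right by lra; apply Rmax_left; lra. }
set (c := (Cconj (g z) / RtoC (Cmod (g z)))%C).
assert (Hr0 : RtoC (Cmod (g z)) <> 0%C) by (intros E; apply RtoC_inj in E; lra).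
assert (Hc1 : Cmod c = 1).
{ unfold c; rewrite Cmod_div, Cmod_conj, Cmod_R, Rabs_right by (auto; lra); field; lra. }
assert (Hcz : (c * g z)%C = RtoC (Cmod (g z))).
{ unfold c; replace (Cconj (g z) / RtoC (Cmod (g z)) * g z)%C
    with (g z * Cconj (g z) / RtoC (Cmod (g z)))%C by (field; auto).
  rewrite <- Cmod2_conj.
  replace (RtoC (Cmod (g z) ^ 2)) with (RtoC (Cmod (g z)) * RtoC (Cmod (g z)))%C
    by (rewrite <- RtoC_mult; f_equal; ring).
  field; auto. }
destruct a as [a b], z as [x y].
assert (Hcg : forall u v, square_dist (u, v) (a, b) <= rho ->
   C_continuous_at (fun w => c * g w)%C (u, v))
  by (intros; apply C_continuous_scal, Hc; auto).
assert (H : Re (c * g (x, y)) <= B).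
{ apply (maximum_principle (fun x y => Re (c * g (x, y))%C) a b rho B); auto.
  - intros u v Huv; apply (C_continuous_Re (fun w => c * g w)%C), Hcg, Huv.
  - intros u v Huv; destruct (Hd (u, v) Huv) as [delta [Hdelta H]].
    apply (local_mean_value_Re (fun w => c * g w)%C u v delta); auto.
    + apply Hcg; apply Rlt_le, Huv.
    + intros w Hw; destruct (H w Hw) as [l Hl]; eexists.
      apply is_C_derive_mult; [apply @is_derive_const|exact Hl].
  - intros u v Huv; eapply Rle_trans; [apply Rle_abs|].
    eapply Rle_trans; [apply re_le_Cmod|].
    rewrite Cmod_mult, Hc1, Rmult_1_l; apply HB, Huv. }
rewrite Hcz in H; simpl in H; lra.
Qed.

Lemma square_dist_le_Cmod (z a : C) : square_dist z a <= Cmod (z - a).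
Proof. exact (Rmax_Cmod (z - a)%C). Qed.

Lemma Cmod_le_square_dist (z a : C) : Cmod (z - a) <= 3 / 2 * square_dist z a.
Proof.
eapply Rle_trans; [apply Cmod_2Rmax|]; apply Rmult_le_compat_r.
- eapply Rle_trans; [apply Rabs_pos|apply Rmax_l].
- apply Rsqr_incr_0_var; [|lra]; rewrite Rsqr_sqrt by lra; unfold Rsqr; lra.
Qed.

Lemma Cminus_neq_0 (z a : C) : z <> a -> (z - a)%C <> 0%C.
Proof.
intros H E; apply H; replace z with (z - a + a)%C by ring; rewrite E; ring.
Qed.

(** On the boundary of the square of half side rho about a, the difference
    quotient is at most 2 M / rho, and the maximum principle carries this bound
    inside. *)
Lemma difference_quotient_bound (f : C -> C) (a : C) (rho M : R) :
  0 < rho ->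
  (forall z, Cmod (z - a) < 2 * rho -> exists l, is_C_derive f z l) ->
  (forall z, Cmod (z - a) < 2 * rho -> Cmod (f z) <= M) ->
  forall w, Cmod (w - a) <= rho -> Cmod (f w - f a) <= 2 * M / rho * Cmod (w - a).
Proof.
intros Hrho Hf HM.
assert (Ha : Cmod (a - a) < 2 * rho)
  by (replace (a - a)%C with (RtoC 0) by ring; rewrite Cmod_0; lra).
destruct (Hf a Ha) as [l Hl].
pose (q := fun z => if excluded_middle_informative (z = a) then l
                    else ((f z - f a) * / (z - a))%C).
assert (Hqa : q a = l)
  by (unfold q; destruct (excluded_middle_informative (a = a)); tauto).
assert (Hq : forall z, z <> a -> q z = ((f z - f a) * / (z - a))%C)
  by (intros z Hz; unfold q; destruct (excluded_middle_informative (z = a)); tauto).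
assert (Hqd : forall z, Cmod (z - a) < 2 * rho -> z <> a -> exists l', is_C_derive q z l').
{ intros z Hz Hza; destruct (Hf z Hz) as [m Hm].
  eexists; eapply (@is_derive_ext_loc C_AbsRing C_NormedModule).
  2:{ apply is_C_derive_mult; [|apply (is_C_derive_inv a z Hza)].
      apply (@is_derive_minus C_AbsRing C_NormedModule); [exact Hm|].
      apply (@is_derive_const C_AbsRing C_NormedModule (f a)). }
  assert (Hp : 0 < Cmod (z - a)) by now apply Cmod_gt_0, Cminus_neq_0.
  exists (mkposreal _ Hp); intros w Hw; symmetry; apply Hq; intros ->.
  change (Cmod (a - z) < Cmod (z - a)) in Hw.
  replace (a - z)%C with (- (z - a))%C in Hw by ring; rewrite Cmod_opp in Hw; lra. }
assert (Hqc : forall z, Cmod (z - a) < 2 * rho -> C_continuous_at q z).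
{ intros z Hz; destruct (classic (z = a)) as [->|Hza].
  2:{ destruct (Hqd z Hz Hza) as [l' Hl']; eapply is_C_derive_continuous, Hl'. }
  intros eps Heps.
  destruct (proj1 (is_C_derive_iff _ _ _) Hl (eps / 2) ltac:(lra)) as [d [Hd Hfd]].
  exists d; split; auto; intros w Hw; rewrite Hqa.
  destruct (classic (w = a)) as [->|Hwa].
  - rewrite Hqa; replace (l - l)%C with (RtoC 0) by ring; rewrite Cmod_0; lra.
  - rewrite Hq by auto; specialize (Hfd w Hw).
    pose proof (Cminus_neq_0 w a Hwa) as Hn; pose proof (proj1 (Cmod_gt_0 _) Hn) as Hp.
    replace ((f w - f a) * / (w - a) - l)%C
      with ((f w - f a - l * (w - a)) / (w - a))%C by (field; auto).
    rewrite Cmod_div by auto; apply Rlt_div_l; auto; nra. }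
assert (Hbd : forall z, square_dist z a <= rho -> Cmod (q z) <= 2 * M / rho).
{ apply maximum_modulus; auto.
  - intros z Hz; apply Hqc; pose proof (Cmod_le_square_dist z a); lra.
  - intros z Hz; pose proof (Cmod_le_square_dist z a) as Hz2.
    destruct (classic (z = a)) as [->|Hza].
    + exists (2 * rho); split; [lra|]; intros w [Hw1 Hw2]; apply Hqd; auto.
      intros ->; replace (a - a)%C with (RtoC 0) in Hw1 by ring; rewrite Cmod_0 in Hw1; lra.
    + assert (Hp : 0 < Cmod (z - a)) by now apply Cmod_gt_0, Cminus_neq_0.
      exists (Rmin (Cmod (z - a)) (2 * rho - Cmod (z - a))); split; [apply Rmin_pos; lra|].
      intros w [Hw1 Hw2].
      pose proof (Rmin_l (Cmod (z - a)) (2 * rho - Cmod (z - a))).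
      pose proof (Rmin_r (Cmod (z - a)) (2 * rho - Cmod (z - a))).
      apply Hqd.
      * pose proof (Cmod_triangle (w - z) (z - a)) as Ht.
        replace (w - z + (z - a))%C with (w - a)%C in Ht by ring; lra.
      * intros ->; replace (a - z)%C with (- (z - a))%C in Hw2 by ring.
        rewrite Cmod_opp in Hw2; lra.
  - intros z Hz; pose proof (Cmod_le_square_dist z a); pose proof (square_dist_le_Cmod z a).
    assert (Hza : z <> a).
    { intros ->; replace (a - a)%C with (RtoC 0) in * by ring; rewrite Cmod_0 in *; lra. }
    rewrite Hq by auto; change (Cmod ((f z - f a) / (z - a)) <= 2 * M / rho).
    rewrite Cmod_div by now apply Cminus_neq_0.
    assert (Hn : Cmod (f z - f a) <= 2 * M).
    { pose proof (Cmod_triangle (f z) (- f a)) as Ht; rewrite Cmod_opp in Ht.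
      pose proof (HM z ltac:(lra)); pose proof (HM a Ha); unfold Cminus; lra. }
    apply Rle_div_l; [lra|].
    pose proof (Cmod_ge_0 (f z - f a)).
    replace (2 * M / rho * Cmod (z - a)) with (2 * M * (Cmod (z - a) / rho)) by (field; lra).
    assert (1 <= Cmod (z - a) / rho) by (apply Rle_div_r; lra); nra. }
intros w Hw; destruct (classic (w = a)) as [->|Hwa].
- replace (f a - f a)%C with (RtoC 0) by ring; replace (a - a)%C with (RtoC 0) by ring.
  rewrite Cmod_0; lra.
- pose proof (square_dist_le_Cmod w a).
  specialize (Hbd w ltac:(lra)); rewrite Hq in Hbd by auto.
  replace (f w - f a)%C with ((f w - f a) * / (w - a) * (w - a))%C
    by (field; now apply Cminus_neq_0).
  rewrite Cmod_mult; apply Rmult_le_compat_r; [apply Cmod_ge_0|exact Hbd].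
Qed.

(** * Uniform limits of holomorphic functions *)

Lemma is_lim_seq_0_small (e : nat -> R) (eps : R) :
  is_lim_seq e 0 -> 0 < eps -> exists N, forall n, (N <= n)%nat -> e n < eps.
Proof.
intros He Heps; apply is_lim_seq_spec in He.
destruct (He (mkposreal _ Heps)) as [N HN]; exists N; intros n Hn.
specialize (HN n Hn); simpl in HN; rewrite Rminus_0_r in HN.
apply Rabs_def2 in HN; lra.
Qed.

Lemma C_cauchy_limit (s : nat -> C) (e : nat -> R) :
  is_lim_seq e 0 -> (forall m n, Cmod (s m - s n) <= e m + e n) ->
  exists l, forall n, Cmod (l - s n) <= e n.
Proof.
intros He Hs.
assert (Hcv : forall p : C -> R, (forall u v, Rabs (p u - p v) <= Cmod (u - v)) ->
   ex_finite_lim_seq (fun n => p (s n))).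
{ intros p Hp; apply ex_lim_seq_cauchy_corr; intros eps.
  assert (Heps : 0 < eps / 2) by (pose proof (cond_pos eps); lra).
  destruct (is_lim_seq_0_small e _ He Heps) as [N HN].
  exists N; intros n m Hn Hm; eapply Rle_lt_trans; [apply Hp|].
  eapply Rle_lt_trans; [apply Hs|]; pose proof (HN n Hn); pose proof (HN m Hm); lra. }
destruct (Hcv Re) as [x Hx]; [intros u v; exact (re_le_Cmod (u - v)%C)|].
destruct (Hcv Im) as [y Hy]; [intros u v; exact (Rabs_Im_le_Cmod (u - v)%C)|].
exists (x, y); intros n; apply le_epsilon; intros eps Heps.
assert (H4 : 0 < eps / 4) by lra.
apply is_lim_seq_spec in Hx, Hy.
destruct (Hx (mkposreal _ H4)) as [N1 HN1], (Hy (mkposreal _ H4)) as [N2 HN2]; simpl in HN1, HN2.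
destruct (is_lim_seq_0_small e _ He H4) as [N3 HN3].
set (m := (N1 + N2 + N3)%nat).
specialize (HN1 m ltac:(unfold m; lia)); specialize (HN2 m ltac:(unfold m; lia)).
specialize (HN3 m ltac:(unfold m; lia)).
pose proof (Cmod_triangle ((x, y) - s m) (s m - s n)) as Ht.
replace ((x, y) - s m + (s m - s n))%C with ((x, y) - s n)%C in Ht by ring.
specialize (Hs m n).
assert (Hm : Cmod ((x, y) - s m) <= 3 / 2 * (eps / 4)).
{ eapply Rle_trans; [apply Cmod_le_square_dist|]; apply Rmult_le_compat_l; [lra|].
  unfold square_dist; simpl; apply Rmax_lub; rewrite Rabs_minus_sym; apply Rlt_le; assumption. }
lra.
Qed.

Lemma is_C_derive_bound (f : C -> C) (a l : C) (rho K : R) :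
  0 < rho -> is_C_derive f a l ->
  (forall w, Cmod (w - a) <= rho -> Cmod (f w - f a) <= K * Cmod (w - a)) ->
  Cmod l <= K.
Proof.
intros Hrho Hl HK; apply le_epsilon; intros eps Heps.
destruct (proj1 (is_C_derive_iff _ _ _) Hl eps Heps) as [d [Hd Hf]].
pose (r := Rmin (d / 2) rho); assert (Hr : 0 < r) by (apply Rmin_pos; lra).
assert (r <= d / 2 /\ r <= rho) as [Hr1 Hr2] by (split; [apply Rmin_l|apply Rmin_r]).
specialize (Hf (a + r)%C); specialize (HK (a + r)%C).
replace (a + r - a)%C with (RtoC r) in * by ring.
rewrite Cmod_R, Rabs_right in * by lra.
specialize (Hf ltac:(lra)); specialize (HK ltac:(lra)).
pose proof (Cmod_triangle (f (a + r)%C - f a) (- (f (a + r)%C - f a - l * r))) as Ht.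
replace (f (a + r) - f a + - (f (a + r) - f a - l * r))%C with (l * r)%C in Ht by ring.
rewrite Cmod_opp, Cmod_mult, Cmod_R, Rabs_right in Ht by lra.
apply Rmult_le_reg_r with r; auto; lra.
Qed.

(** For m, n large, S m - S n is uniformly small, hence by
    [difference_quotient_bound] so is its difference quotient at a, uniformly in the
    increment.  So the derivatives at a form a Cauchy sequence, and F - S n has a
    small difference quotient too. *)
Theorem uniform_limit_derivable (S : nat -> C -> C) (F : C -> C) (a : C) (r : R)
    (e : nat -> R) :
  0 < r -> is_lim_seq e 0 ->
  (forall n z, Cmod (z - a) < r -> exists l, is_C_derive (S n) z l) ->
  (forall n z, Cmod (z - a) < r -> Cmod (F z - S n z) <= e n) ->
  exists l, is_C_derive F a l.
Proof.
intros Hr He HS HF.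
assert (Ha : Cmod (a - a) < r)
  by (replace (a - a)%C with (RtoC 0) by ring; rewrite Cmod_0; lra).
destruct (functional_choice (fun n l => is_C_derive (S n) a l)) as [D HD];
  [intros n; exact (HS n a Ha)|].
set (k := 4 / r); assert (Hk : 0 < k) by (apply Rdiv_lt_0_compat; lra).
assert (Hlip : forall m n w, Cmod (w - a) <= r / 2 ->
   Cmod ((S m w - S n w) - (S m a - S n a)) <= k * (e m + e n) * Cmod (w - a)).
{ intros m n w Hw.
  replace (k * (e m + e n)) with (2 * (e m + e n) / (r / 2)) by (unfold k; field; lra).
  apply (difference_quotient_bound (fun z => S m z - S n z)%C); auto; [lra| |].
  - intros z Hz; destruct (HS m z ltac:(lra)) as [l1 H1], (HS n z ltac:(lra)) as [l2 H2].
    eexists; apply (@is_derive_minus C_AbsRing C_NormedModule); [exact H1|exact H2].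
  - intros z Hz; pose proof (HF m z ltac:(lra)) as H1; pose proof (HF n z ltac:(lra)) as H2.
    replace (S m z - S n z)%C with ((F z - S n z) + - (F z - S m z))%C by ring.
    eapply Rle_trans; [apply Cmod_triangle|]; rewrite Cmod_opp; lra. }
assert (HDm : forall m n, Cmod (D m - D n) <= k * e m + k * e n).
{ intros m n; rewrite <- Rmult_plus_distr_l.
  apply (is_C_derive_bound (fun z => S m z - S n z)%C a _ (r / 2)); [lra| |].
  - apply (@is_derive_minus C_AbsRing C_NormedModule); apply HD.
  - apply Hlip. }
assert (Hke : is_lim_seq (fun n => k * e n) 0).
{ replace (Finite 0) with (Rbar_mult k 0) by (simpl; f_equal; ring).
  now apply is_lim_seq_scal_l. }
destruct (C_cauchy_limit D _ Hke HDm) as [L HL].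
exists L; apply is_C_derive_iff; intros eps Heps.
assert (H8 : 0 < eps / 8) by lra.
destruct (is_lim_seq_0_small _ _ Hke H8) as [N HN].
pose proof (HN N (le_n N)) as HkN.
destruct (proj1 (is_C_derive_iff _ _ _) (HD N) (eps / 2) ltac:(lra)) as [d [Hd HdN]].
exists (Rmin d (r / 2)); split; [apply Rmin_pos; lra|]; intros w Hw.
pose proof (Rmin_l d (r / 2)); pose proof (Rmin_r d (r / 2)).
specialize (HdN w ltac:(lra)); specialize (HL N).
pose proof (Cmod_ge_0 (w - a)) as Hwa.
assert (Hlim : Cmod ((F w - S N w) - (F a - S N a)) <= k * e N * Cmod (w - a)
                                                        + eps / 8 * Cmod (w - a)).
{ apply le_epsilon; intros eta Heta.
  assert (H4 : 0 < eta / 2) by lra.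
  destruct (is_lim_seq_0_small _ _ He H4) as [N1 HN1].
  set (m := (N + N1)%nat).
  specialize (HN m ltac:(unfold m; lia)); specialize (HN1 m ltac:(unfold m; lia)).
  pose proof (Hlip m N w ltac:(lra)) as Hm.
  pose proof (HF m w ltac:(lra)) as Hm1; pose proof (HF m a Ha) as Hm2.
  replace ((F w - S N w) - (F a - S N a))%C with
    ((S m w - S N w) - (S m a - S N a) + ((F w - S m w) + - (F a - S m a)))%C by ring.
  eapply Rle_trans; [apply Cmod_triangle|].
  pose proof (Cmod_triangle (F w - S m w) (- (F a - S m a))) as Ht; rewrite Cmod_opp in Ht.
  assert (k * e m * Cmod (w - a) <= eps / 8 * Cmod (w - a)) by (apply Rmult_le_compat_r; lra).
  lra. }
replace (F w - F a - L * (w - a))%C with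
  ((F w - S N w) - (F a - S N a) + ((S N w - S N a - D N * (w - a)) + - ((L - D N) * (w - a))))%C
  by ring.
eapply Rle_trans; [apply Cmod_triangle|].
pose proof (Cmod_triangle (S N w - S N a - D N * (w - a)) (- ((L - D N) * (w - a)))) as Ht.
rewrite Cmod_opp, Cmod_mult in Ht.
assert (Cmod (L - D N) * Cmod (w - a) <= eps / 8 * Cmod (w - a))
  by (apply Rmult_le_compat_r; lra).
assert (k * e N * Cmod (w - a) <= eps / 8 * Cmod (w - a)) by (apply Rmult_le_compat_r; lra).
assert (0 <= eps * Cmod (w - a)) by (apply Rmult_le_pos; lra).
lra.
Qed.

(** * The regions and the associated growth *)

Lemma radii_Cmod (G : region) (z : C) : in_region G z -> radii G (Cmod z).
Proof. pose proof (Cmod_ge_0 z); destruct G; simpl; [auto|lra]. Qed.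

Lemma in_region_RtoC (G : region) (t : R) : radii G t -> in_region G (RtoC t).
Proof.
destruct G; simpl; auto; intros H; rewrite Cmod_R, Rabs_right; lra.
Qed.

Lemma Cmod_radius (G : region) (t : R) : radii G t -> Cmod (RtoC t) = t.
Proof. destruct G; simpl; intros H; rewrite Cmod_R, Rabs_right; lra. Qed.

Lemma region_neighborhood (G : region) (a : C) :
  in_region G a -> exists r s, 0 < r /\ radii G s /\
    forall z, Cmod (z - a) < r -> in_region G z /\ Cmod z <= s.
Proof.
intros Ha; pose proof (Cmod_ge_0 a) as Ha0.
pose (r := match G with plane => 1 | Defs.disc => (1 - Cmod a) / 2 end).
exists r, (Cmod a + r).
assert (Hz : forall z, Cmod (z - a) < r -> Cmod z <= Cmod a + r).
{ intros z Hz; pose proof (Cmod_triangle (z - a) a) as Ht.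
  replace (z - a + a)%C with z in Ht by ring; lra. }
unfold r in *; destruct G; simpl in *; repeat split; try lra; auto.
specialize (Hz z H); lra.
Qed.

Lemma growth_pos (G : region) (v : R -> R) :
  is_weight G v -> forall t, radii G t -> 0 < growth v t.
Proof. intros H t Ht; apply Rinv_0_lt_compat, (weight_pos G v H t Ht). Qed.

Lemma growth_nondecreasing (G : region) (v : R -> R) :
  is_weight G v -> forall s t, radii G s -> radii G t -> s <= t -> growth v s <= growth v t.
Proof.
intros H s t Hs Ht Hst; apply Rinv_le_contravar; [apply (weight_pos G v H t Ht)|].
now apply (weight_noninc G v H).
Qed.

Lemma weighted_le_growth (G : region) (v : R -> R) (z : C) (x K : R) :
  is_weight G v -> in_region G z ->
  (x * v (Cmod z) <= K <-> x <= K * growth v (Cmod z)).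
Proof.
intros H Hz; pose proof (weight_pos G v H _ (radii_Cmod G z Hz)) as Hp.
unfold growth; change (K * / v (Cmod z)) with (K / v (Cmod z)).
split; intros HK; [now apply Rle_div_r|now apply Rle_div_r in HK].
Qed.

Lemma holomorphic_const (G : region) (c : C) : holomorphic G (fun _ => c).
Proof. intros z _; exists (RtoC 0); apply (@is_derive_const C_AbsRing C_NormedModule). Qed.

Lemma holomorphic_plus (G : region) (f g : C -> C) :
  holomorphic G f -> holomorphic G g -> holomorphic G (fun z => f z + g z)%C.
Proof. intros Hf Hg z Hz; apply (@ex_derive_plus C_AbsRing C_NormedModule); auto. Qed.

Lemma holomorphic_minus (G : region) (f g : C -> C) :
  holomorphic G f -> holomorphic G g -> holomorphic G (fun z => f z - g z)%C.
Proof. intros Hf Hg z Hz; apply (@ex_derive_minus C_AbsRing C_NormedModule); auto. Qed.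

Lemma holomorphic_scal (G : region) (c : C) (f : C -> C) :
  holomorphic G f -> holomorphic G (fun z => c * f z)%C.
Proof.
intros Hf z Hz; destruct (Hf z Hz) as [l Hl]; eexists.
apply is_C_derive_mult; [apply (@is_derive_const C_AbsRing C_NormedModule)|exact Hl].
Qed.

Lemma holomorphic_rotation (G : region) (c : C) (f : C -> C) :
  Cmod c = 1 -> holomorphic G f -> holomorphic G (fun z => f (c * z)%C).
Proof.
intros Hc Hf z Hz.
assert (Hm : forall w, Cmod (c * w) = Cmod w)
  by (intros w; rewrite Cmod_mult, Hc; ring).
destruct (Hf (c * z)%C) as [l Hl]; [destruct G; simpl in *; auto; now rewrite Hm|].
exists (l * c)%C; apply is_C_derive_iff; intros eps Heps.
destruct (proj1 (is_C_derive_iff _ _ _) Hl eps Heps) as [d [Hd H]].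
exists d; split; auto; intros w Hw; specialize (H (c * w)%C).
replace (c * w - c * z)%C with (c * (w - z))%C in H by ring.
rewrite Hm in H; rewrite <- Cmult_assoc; auto.
Qed.

Lemma assoc_growth_is_lub (G : region) (w : R -> R) (z : C) :
  (forall t, radii G t -> 0 < w t) -> in_region G z ->
  is_lub_Rbar (fun x => exists f, growth_ball G w f /\ x = Cmod (f z))
    (assoc_growth G w z).
Proof.
intros Hw Hz; unfold assoc_growth.
pose proof (Lub_Rbar_correct (fun x => exists f, growth_ball G w f /\ x = Cmod (f z))) as H.
destruct (Lub_Rbar _) as [l| |]; [exact H| |]; exfalso; destruct H as [Hub Hlub].
- apply (Hlub (w (Cmod z))); intros x [f [[_ Hf] ->]]; now apply Hf.
- apply (Hub (Cmod 0)); exists (fun _ => 0%C); split; [split|reflexivity].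
  + apply holomorphic_const.
  + intros y Hy; rewrite Cmod_0; apply Rlt_le, Hw, radii_Cmod, Hy.
Qed.

Lemma assoc_growth_ge (G : region) (w : R -> R) (f : C -> C) (z : C) :
  (forall t, radii G t -> 0 < w t) -> in_region G z ->
  growth_ball G w f -> Cmod (f z) <= assoc_growth G w z.
Proof.
intros Hw Hz Hf; apply (proj1 (assoc_growth_is_lub G w z Hw Hz)); now exists f.
Qed.

Lemma assoc_growth_le (G : region) (w : R -> R) (z : C) (M : R) :
  (forall t, radii G t -> 0 < w t) -> in_region G z ->
  (forall f, growth_ball G w f -> Cmod (f z) <= M) -> assoc_growth G w z <= M.
Proof.
intros Hw Hz H; apply (proj2 (assoc_growth_is_lub G w z Hw Hz) M).
intros x [f [Hf ->]]; exact (H f Hf).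
Qed.

Lemma assoc_growth_le_growth (G : region) (w : R -> R) (z : C) :
  (forall t, radii G t -> 0 < w t) -> in_region G z ->
  assoc_growth G w z <= w (Cmod z).
Proof. intros Hw Hz; apply assoc_growth_le; auto; intros f [_ Hf]; auto. Qed.

(** The extremal function controls, up to the factor K, every function of growth
    K w, not only those of the unit ball. *)
Lemma assoc_growth_scale (G : region) (w : R -> R) (f : C -> C) (K : R) :
  (forall t, radii G t -> 0 < w t) -> 0 < K -> holomorphic G f ->
  (forall z, in_region G z -> Cmod (f z) <= K * w (Cmod z)) ->
  forall z, in_region G z -> Cmod (f z) <= K * assoc_growth G w z.
Proof.
intros Hw HK Hf H z Hz.
assert (Hs : forall y, Cmod (RtoC (/ K) * f y) = / K * Cmod (f y)).
{ intros y; rewrite Cmod_mult, Cmod_R, Rabs_right; auto.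
  apply Rle_ge, Rlt_le, Rinv_0_lt_compat, HK. }
apply Rmult_le_reg_l with (/ K); [now apply Rinv_0_lt_compat|].
rewrite <- Hs, <- Rmult_assoc, Rinv_l, Rmult_1_l by lra.
apply (assoc_growth_ge G w (fun y => RtoC (/ K) * f y)%C); auto; split.
- now apply holomorphic_scal.
- intros y Hy; rewrite Hs; apply Rmult_le_reg_l with K; auto.
  rewrite <- Rmult_assoc, Rinv_r, Rmult_1_l by lra; auto.
Qed.

(** Composing with the rotation that sends |z| to z preserves the unit ball. *)
Lemma assoc_growth_radial (G : region) (w : R -> R) (z : C) :
  (forall t, radii G t -> 0 < w t) -> in_region G z ->
  assoc_growth G w z <= assoc_growth G w (RtoC (Cmod z)).
Proof.
intros Hw Hz; apply assoc_growth_le; auto; intros f [Hf Hb].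
pose proof (in_region_RtoC G _ (radii_Cmod G z Hz)) as Hz'.
destruct (classic (z = RtoC 0)) as [->|Hz0].
{ rewrite Cmod_0; apply assoc_growth_ge; auto; now split. }
assert (Hp : 0 < Cmod z) by now apply Cmod_gt_0.
assert (Hr0 : RtoC (Cmod z) <> 0%C) by (intros E; apply RtoC_inj in E; lra).
set (c := (z / RtoC (Cmod z))%C).
assert (Hc : Cmod c = 1)
  by (unfold c; rewrite Cmod_div, Cmod_R, Rabs_right by (auto; lra); field; lra).
replace (f z) with (f (c * RtoC (Cmod z))%C) by (f_equal; unfold c; field; auto).
apply (assoc_growth_ge G w (fun y => f (c * y)%C)); auto; split.
- now apply holomorphic_rotation.
- intros y Hy; assert (E : Cmod (c * y) = Cmod y) by (rewrite Cmod_mult, Hc; ring).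
  rewrite <- E; apply Hb; destruct G; simpl in *; auto; now rewrite E.
Qed.

(** Since [growth v] is nondecreasing, the constant [growth v 0] lies in the unit
    ball. *)
Lemma assoc_growth_pos (G : region) (v : R -> R) (z : C) :
  is_weight G v -> in_region G z -> 0 < assoc_growth G (growth v) z.
Proof.
intros Hv Hz.
assert (H0 : radii G 0) by (destruct G; simpl; lra).
pose proof (growth_pos G v Hv 0 H0) as Hp.
apply Rlt_le_trans with (Cmod (RtoC (growth v 0)));
  [rewrite Cmod_R, Rabs_right; lra|].
apply (assoc_growth_ge G (growth v) (fun _ => RtoC (growth v 0))); auto.
- now apply growth_pos.
- split; [apply holomorphic_const|]; intros y Hy.
  rewrite Cmod_R, Rabs_right by lra.
  apply (growth_nondecreasing G v Hv); auto; [now apply radii_Cmod|apply Cmod_ge_0].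
Qed.

Lemma assoc_growth_half_attained (G : region) (w : R -> R) (z : C) :
  (forall t, radii G t -> 0 < w t) -> in_region G z ->
  exists f, growth_ball G w f /\ assoc_growth G w z <= 2 * Cmod (f z).
Proof.
intros Hw Hz; apply NNPP; intros H.
set (A := assoc_growth G w z).
assert (Hlt : forall f, growth_ball G w f -> Cmod (f z) < A / 2).
{ intros f Hf; apply Rnot_le_lt; intros Hle; apply H; exists f; fold A; split; auto; lra. }
assert (HA : A <= A / 2)
  by (apply assoc_growth_le; auto; intros f Hf; apply Rlt_le, Hlt, Hf).
assert (H0 : Cmod 0 < A / 2).
{ apply (Hlt (fun _ => 0%C)); split; [apply holomorphic_const|].
  intros y Hy; rewrite Cmod_0; apply Rlt_le, Hw, radii_Cmod, Hy. }
rewrite Cmod_0 in H0; lra.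
Qed.

(** * The gliding hump *)

Lemma eighth_pow_pos (n : nat) : 0 < (/ 8) ^ n.
Proof. apply pow_lt; lra. Qed.

Lemma is_lim_seq_eighth_pow (M : R) : is_lim_seq (fun n => M * (/ 8) ^ n) 0.
Proof.
replace (Finite 0) with (Rbar_mult M 0) by (simpl; f_equal; ring).
apply is_lim_seq_scal_l, is_lim_seq_geom; rewrite Rabs_right; lra.
Qed.

Lemma geometric_increments (s : nat -> C) (M : R) :
  (forall n, Cmod (s (S n) - s n) <= M * (/ 8) ^ n) ->
  exists l, forall n, Cmod (l - s n) <= 8 / 7 * M * (/ 8) ^ n.
Proof.
intros Hs.
assert (HM : 0 <= M) by (specialize (Hs 0%nat); simpl in Hs;
  pose proof (Cmod_ge_0 (s 1%nat - s 0%nat)); lra).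
assert (Hk : forall n k, Cmod (s (n + k)%nat - s n)
               <= 8 / 7 * M * (/ 8) ^ n - 8 / 7 * M * (/ 8) ^ (n + k)).
{ intros n k; induction k as [|k IH].
  - rewrite Nat.add_0_r; replace (s n - s n)%C with (RtoC 0) by ring; rewrite Cmod_0; lra.
  - rewrite Nat.add_succ_r; specialize (Hs (n + k)%nat).
    replace (s (S (n + k)) - s n)%C with
      ((s (S (n + k)) - s (n + k)%nat) + (s (n + k)%nat - s n))%C by ring.
    eapply Rle_trans; [apply Cmod_triangle|].
    replace ((/ 8) ^ S (n + k)) with ((/ 8) ^ (n + k) / 8) by (simpl; lra); lra. }
apply C_cauchy_limit; [apply is_lim_seq_eighth_pow|].
assert (Hp : forall n, 0 <= 8 / 7 * M * (/ 8) ^ n)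
  by (intros n; apply Rmult_le_pos; [lra|apply Rlt_le, eighth_pow_pos]).
intros m n; destruct (Nat.le_ge_cases n m) as [Hle|Hle].
- replace m with (n + (m - n))%nat at 1 by lia.
  eapply Rle_trans; [apply Hk|].
  pose proof (Hp m); pose proof (Hp (n + (m - n))%nat); lra.
- replace (s m - s n)%C with (- (s n - s m))%C by ring; rewrite Cmod_opp.
  replace n with (m + (n - m))%nat at 1 by lia.
  eapply Rle_trans; [apply Hk|].
  pose proof (Hp n); pose proof (Hp (m + (n - m))%nat); lra.
Qed.

(** One function of [Hinf G u] that comes, simultaneously for all n, within a
    factor of order 8^n of the largest possible modulus at p n.  At each step the
    term 8^-n f n is added only if the partial sum is still too small at p n; in
    both cases the next partial sum has modulus at least 8^-n |f n (p n)| / 2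
    there, that is, 8^-n A / 4 with A the associated growth at p n.  All later
    terms together contribute at most 8^-n A / 7, and 10 exceeds the inverse of
    1/4 - 1/7 = 3/28. *)
Theorem gliding_hump (G : region) (u : R -> R) (p : nat -> C) :
  is_weight G u -> (forall n, in_region G (p n)) ->
  exists F, holomorphic G F /\
    (forall z, in_region G z -> Cmod (F z) <= 2 * growth u (Cmod z)) /\
    forall n, assoc_growth G (growth u) (p n) * (/ 8) ^ n <= 10 * Cmod (F (p n)).
Proof.
intros Hu Hp; set (w := growth u).
assert (Hw : forall t, radii G t -> 0 < w t) by now apply growth_pos.
destruct (functional_choice (fun n f => growth_ball G w f /\
   assoc_growth G w (p n) <= 2 * Cmod (f (p n)))) as [f Hf].
{ intros n; apply assoc_growth_half_attained; auto. }
(* The partial sums of the final series. *)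
pose (T := fix T (n : nat) : C -> C := match n with
  | O => fun _ => RtoC 0
  | S m => fun z =>
     (T m z + RtoC (if Rle_dec (Cmod (T m (p m))) ((/ 8) ^ m * Cmod (f m (p m)) / 2)
                    then (/ 8) ^ m else 0) * f m z)%C
  end).
assert (Hsig : forall n, exists s, 0 <= s <= (/ 8) ^ n /\
   (forall z, T (S n) z = T n z + RtoC s * f n z)%C /\
   (/ 8) ^ n * Cmod (f n (p n)) / 2 <= Cmod (T (S n) (p n))).
{ intros n; simpl; pose proof (eighth_pow_pos n) as He.
  destruct (Rle_dec _ _) as [Hle|Hgt].
  - exists ((/ 8) ^ n); split; [lra|]; split; [reflexivity|].
    pose proof (Cmod_triangle (T n (p n) + RtoC ((/ 8) ^ n) * f n (p n)) (- T n (p n))) as Ht.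
    replace (T n (p n) + RtoC ((/ 8) ^ n) * f n (p n) + - T n (p n))%C
      with (RtoC ((/ 8) ^ n) * f n (p n))%C in Ht by ring.
    rewrite Cmod_opp, Cmod_mult, Cmod_R, Rabs_right in Ht by lra; lra.
  - exists 0; split; [lra|]; split; [reflexivity|].
    replace (T n (p n) + RtoC 0 * f n (p n))%C with (T n (p n)) by ring; lra. }
assert (Hinc : forall n z, in_region G z ->
   Cmod (T (S n) z - T n z) <= assoc_growth G w z * (/ 8) ^ n).
{ intros n z Hz; destruct (Hsig n) as [s [Hs [HT _]]]; rewrite HT.
  replace (T n z + RtoC s * f n z - T n z)%C with (RtoC s * f n z)%C by ring.
  rewrite Cmod_mult, Cmod_R, Rabs_right, Rmult_comm by lra.
  apply Rmult_le_compat; [apply Cmod_ge_0|lra| |lra].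
  apply assoc_growth_ge; auto; apply Hf. }
destruct (functional_choice (fun z l => in_region G z -> forall n,
   Cmod (l - T n z) <= 8 / 7 * assoc_growth G w z * (/ 8) ^ n)) as [F HF].
{ intros z; destruct (classic (in_region G z)) as [Hz|Hz].
  - destruct (geometric_increments (fun n => T n z) (assoc_growth G w z)) as [l Hl]; auto.
    now exists l.
  - exists 0%C; tauto. }
assert (HT : forall n, holomorphic G (T n)).
{ induction n as [|n IH]; [apply holomorphic_const|].
  simpl; apply holomorphic_plus; auto; apply holomorphic_scal, Hf. }
exists F; repeat split.
- intros a Ha; destruct (region_neighborhood G a Ha) as [r [s [Hr [Hs Hz]]]].
  apply (uniform_limit_derivable T F a r (fun n => 8 / 7 * w s * (/ 8) ^ n)); auto.
  + apply is_lim_seq_eighth_pow.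
  + intros n z Hza; apply HT, Hz, Hza.
  + intros n z Hza; destruct (Hz z Hza) as [Hz1 Hz2].
    eapply Rle_trans; [apply HF, Hz1|].
    apply Rmult_le_compat_r; [apply Rlt_le, eighth_pow_pos|].
    apply Rmult_le_compat_l; [lra|].
    eapply Rle_trans; [now apply assoc_growth_le_growth|].
    apply (growth_nondecreasing G u Hu); auto; now apply radii_Cmod.
- intros z Hz; specialize (HF z Hz 0%nat); simpl in HF.
  replace (F z - 0)%C with (F z) in HF by ring.
  pose proof (assoc_growth_le_growth G w z Hw Hz); pose proof (Hw _ (radii_Cmod G z Hz)).
  fold w; lra.
- intros n; destruct (Hsig n) as [s [_ [_ Hn]]]; destruct (Hf n) as [_ Hfn].
  specialize (HF (p n) (Hp n) (S n)).
  replace ((/ 8) ^ S n) with ((/ 8) ^ n / 8) in HF by (simpl; lra).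
  pose proof (eighth_pow_pos n) as He.
  pose proof (Cmod_triangle (F (p n)) (- (F (p n) - T (S n) (p n)))) as Ht.
  replace (F (p n) + - (F (p n) - T (S n) (p n)))%C with (T (S n) (p n)) in Ht by ring.
  rewrite Cmod_opp in Ht.
  pose proof (Cmod_ge_0 (F (p n))).
  assert (assoc_growth G w (p n) * (/ 8) ^ n <= 2 * Cmod (f n (p n)) * (/ 8) ^ n)
    by (apply Rmult_le_compat_r; lra).
  lra.
Qed.

(** * Inclusions of weighted spaces *)

Lemma wnorm_le (G : region) (v : R -> R) (f : C -> C) (M : R) :
  (forall z, in_region G z -> Cmod (f z) * v (Cmod z) <= M) ->
  Rbar_le (wnorm G v f) M.
Proof.
intros H; apply (proj2 (Lub_Rbar_correct _)); intros x [z [Hz ->]]; exact (H z Hz).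
Qed.

Lemma wnorm_ge (G : region) (v : R -> R) (f : C -> C) (z : C) :
  in_region G z -> Rbar_le (Cmod (f z) * v (Cmod z)) (wnorm G v f).
Proof. intros Hz; apply (proj1 (Lub_Rbar_correct _)); now exists z. Qed.

Lemma Hinf_bounded (G : region) (v : R -> R) (f : C -> C) :
  Hinf G v f <->
  holomorphic G f /\ exists M, forall z, in_region G z -> Cmod (f z) * v (Cmod z) <= M.
Proof.
split; intros [Hf H]; split; auto.
- exists (real (wnorm G v f)); intros z Hz; pose proof (wnorm_ge G v f z Hz) as Hge.
  destruct (wnorm G v f); simpl in *; tauto.
- destruct H as [M HM]; apply (Rbar_le_lt_trans _ M); [now apply wnorm_le|exact I].
Qed.

Lemma wpreceq_assoc_weight (G : region) (u v : R -> R) :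
  is_weight G u ->
  (wpreceq G (assoc_weight G u) v <-> exists K, 1 <= K /\
    forall t, radii G t -> assoc_growth G (growth u) (RtoC t) * v t <= K).
Proof.
intros Hu; split; intros [K [HK H]]; exists K; split; auto; intros t Ht;
  specialize (H t Ht); unfold assoc_weight in *;
  pose proof (assoc_growth_pos G u _ Hu (in_region_RtoC G t Ht)) as Hp.
- change (K * / ?A) with (K / A) in H.
  apply Rle_div_r in H; [lra|exact Hp].
- apply Rle_div_r; [exact Hp|lra].
Qed.

Lemma wpreceq_trans (G : region) (u v w : R -> R) :
  wpreceq G u v -> wpreceq G v w -> wpreceq G u w.
Proof.
intros [K [HK H]] [L [HL H']]; exists (L * K); split; [nra|].
intros t Ht; specialize (H t Ht); specialize (H' t Ht).
rewrite Rmult_assoc; eapply Rle_trans; [exact H'|]; apply Rmult_le_compat_l; lra.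
Qed.

(** If [A_u * v] were unbounded, [gliding_hump] at points where it exceeds
    (1 + n) 8^n would produce an element of [Hinf G u] outside [Hinf G v]. *)
Lemma inclusion_bounds_assoc_growth (G : region) (u v : R -> R) :
  is_weight G u -> is_weight G v -> Hinf_incl G u v ->
  wpreceq G (assoc_weight G u) v.
Proof.
intros Hu Hv Hincl; apply wpreceq_assoc_weight; auto; apply NNPP; intros Hno.
set (A := assoc_growth G (growth u)).
destruct (functional_choice (fun n z => in_region G z /\
    (1 + INR n) * 8 ^ n < A z * v (Cmod z))) as [p Hp].
{ intros n; apply NNPP; intros H; apply Hno.
  assert (H1 : 1 <= 8 ^ n) by (apply pow_R1_Rle; lra).
  pose proof (pos_INR n).
  exists ((1 + INR n) * 8 ^ n); split; [nra|]; intros t Ht.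
  apply Rnot_lt_le; intros Hlt; apply H; exists (RtoC t); split.
  - now apply in_region_RtoC.
  - now rewrite (Cmod_radius G t Ht). }
destruct (gliding_hump G u p Hu (fun n => proj1 (Hp n))) as [F [HF [HFu HFp]]].
assert (HFv : Hinf G v F).
{ apply Hincl, Hinf_bounded; split; auto; exists 2; intros z Hz.
  now apply (proj2 (weighted_le_growth G u z _ _ Hu Hz)), HFu. }
apply Hinf_bounded in HFv; destruct HFv as [_ [M HM]].
destruct (nfloor_ex (Rmax 0 (10 * M))) as [n [_ Hn]]; [apply Rmax_l|].
pose proof (Rmax_r 0 (10 * M)).
destruct (Hp n) as [Hz Hlarge]; specialize (HFp n); specialize (HM _ Hz).
fold A in HFp; pose proof (weight_pos G v Hv _ (radii_Cmod G _ Hz)) as Hvp.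
assert (H8 : 0 < 8 ^ n) by (apply pow_lt; lra).
assert (E : 8 ^ n * (/ 8) ^ n = 1).
{ rewrite <- Rpow_mult_distr, Rinv_r, pow1 by lra; reflexivity. }
pose proof (eighth_pow_pos n) as He.
assert (H1 : (1 + INR n) * 8 ^ n * (/ 8) ^ n < A (p n) * v (Cmod (p n)) * (/ 8) ^ n)
  by (apply Rmult_lt_compat_r; auto).
rewrite Rmult_assoc, E, Rmult_1_r in H1.
assert (H2 : A (p n) * (/ 8) ^ n * v (Cmod (p n)) <= 10 * Cmod (F (p n)) * v (Cmod (p n)))
  by (apply Rmult_le_compat_r; lra).
lra.
Qed.

(** A bound K for [A_u * v] is a bound for the norm of the inclusion. *)
Lemma assoc_bound_transfers (G : region) (u v : R -> R) (K M : R) (f : C -> C) :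
  is_weight G u -> is_weight G v -> 0 < M ->
  (forall t, radii G t -> assoc_growth G (growth u) (RtoC t) * v t <= K) ->
  holomorphic G f ->
  (forall z, in_region G z -> Cmod (f z) * u (Cmod z) <= M) ->
  forall z, in_region G z -> Cmod (f z) * v (Cmod z) <= K * M.
Proof.
intros Hu Hv HM HK Hf Hfu z Hz.
assert (Hw : forall t, radii G t -> 0 < growth u t) by now apply growth_pos.
pose proof (weight_pos G v Hv _ (radii_Cmod G z Hz)) as Hvp.
assert (H : Cmod (f z) <= M * assoc_growth G (growth u) z).
{ apply assoc_growth_scale; auto; intros y Hy.
  now apply (proj1 (weighted_le_growth G u y _ _ Hu Hy)), Hfu. }
pose proof (assoc_growth_radial G (growth u) z Hw Hz) as Hr.
specialize (HK _ (radii_Cmod G z Hz)).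
apply Rle_trans with (M * assoc_growth G (growth u) (RtoC (Cmod z)) * v (Cmod z)).
- apply Rmult_le_compat_r; [lra|]; eapply Rle_trans; [exact H|].
  apply Rmult_le_compat_l; lra.
- rewrite Rmult_assoc, (Rmult_comm K); apply Rmult_le_compat_l; lra.
Qed.

Lemma wpreceq_assoc_both (G : region) (u v : R -> R) :
  is_weight G u -> is_weight G v ->
  (wpreceq G (assoc_weight G u) v <-> wpreceq G (assoc_weight G u) (assoc_weight G v)).
Proof.
intros Hu Hv; pose proof (growth_pos G v Hv) as Hwv; pose proof (growth_pos G u Hu) as Hwu.
rewrite !(wpreceq_assoc_weight G u) by auto.
split; intros [K [HK H]]; exists K; split; auto; intros t Ht; specialize (H t Ht) as Ht';
  pose proof (in_region_RtoC G t Ht) as Hz;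
  pose proof (assoc_growth_pos G v _ Hv Hz) as Hp; unfold assoc_weight in *.
- rewrite <- Rdiv_def; apply Rle_div_l; auto; apply assoc_growth_le; auto.
  intros f [Hf Hfu]; apply assoc_growth_scale; auto; [lra|].
  intros z Hz'; apply (proj1 (weighted_le_growth G v z _ _ Hv Hz')).
  rewrite <- (Rmult_1_r K); apply (assoc_bound_transfers G u); auto; [lra|].
  intros y Hy; apply (proj2 (weighted_le_growth G u y _ _ Hu Hy)); rewrite Rmult_1_l; auto.
- rewrite <- Rdiv_def in Ht'; apply Rle_div_l in Ht'; auto.
  pose proof (weight_pos G v Hv t Ht) as Hvt.
  pose proof (assoc_growth_le_growth G (growth v) _ Hwv Hz) as Hle.
  rewrite (Cmod_radius G t Ht) in Hle; unfold growth at 2 in Hle.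
  apply Rle_div_r; auto; unfold Rdiv; eapply Rle_trans; [exact Ht'|].
  apply Rmult_le_compat_l; lra.
Qed.

Lemma wpreceq_assoc_inclusion (G : region) (u v : R -> R) :
  is_weight G u -> is_weight G v ->
  (wpreceq G (assoc_weight G u) v <-> Hinf_incl G u v).
Proof.
intros Hu Hv; split; [|now apply inclusion_bounds_assoc_growth].
intros H f Hf; apply wpreceq_assoc_weight in H; auto; destruct H as [K [HK H]].
apply Hinf_bounded in Hf; destruct Hf as [Hf [M HM]].
apply Hinf_bounded; split; auto; exists (K * Rmax 1 M).
pose proof (Rmax_l 1 M); pose proof (Rmax_r 1 M).
apply (assoc_bound_transfers G u); auto; [lra|].
intros z Hz; specialize (HM z Hz); lra.
Qed.

Lemma inclusion_continuous (G : region) (u v : R -> R) :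
  is_weight G u -> is_weight G v -> Hinf_incl G u v -> Hinf_incl_continuous G u v.
Proof.
intros Hu Hv Hincl; apply wpreceq_assoc_inclusion, wpreceq_assoc_weight in Hincl; auto.
destruct Hincl as [K [HK H]].
intros f [Hf _] eps Heps; exists (eps / (2 * K)); split; [apply Rdiv_lt_0_compat; lra|].
intros g [Hg _] Hlt; apply (Rbar_le_lt_trans _ (eps / 2)); [|simpl; lra].
apply wnorm_le; replace (eps / 2) with (K * (eps / (2 * K))) by (field; lra).
apply (assoc_bound_transfers G u); auto; [apply Rdiv_lt_0_compat; lra| |].
- now apply holomorphic_minus.
- intros z Hz.
  exact (Rbar_lt_le _ _ (Rbar_le_lt_trans _ _ _
           (wnorm_ge G u (fun z => g z - f z)%C z Hz) Hlt)).
Qed.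

Theorem theorem3p2 (G : region) (u v : R -> R)
  (hu : is_weight G u) (hv : is_weight G v) :
  (wpreceq G (assoc_weight G u) v
     <-> wpreceq G (assoc_weight G u) (assoc_weight G v)) /\
  (wpreceq G (assoc_weight G u) (assoc_weight G v) <-> Hinf_incl G u v) /\
  (Hinf_incl G u v -> Hinf_incl_continuous G u v) /\
  (essential G u -> (Hinf_incl G u v <-> wpreceq G u v)).
Proof.
pose proof (wpreceq_assoc_both G u v hu hv) as H12.
pose proof (wpreceq_assoc_inclusion G u v hu hv) as H13.
split; [exact H12|]; split; [tauto|]; split; [now apply inclusion_continuous|].
intros [H1 H2]; split.
- intros Hincl; apply (wpreceq_trans G _ (assoc_weight G u)); tauto.
- intros Huv; apply H13, (wpreceq_trans G _ u); auto.
Qed.
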